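(* Let $Q$ be a finite quiver without oriented cycles and $k$ a finite field. Then the composition algebra $\mathcal C(kQ)$ contains the subalgebra $\mathcal P(kQ)$ of the Hall algebra $\mathcal H(kQ)$ generated by the isomorphism classes of all preprojective modules, and it contains the subalgebra $\mathcal I(kQ)$ generated by the isomorphism classes of all preinjective modules.
   Context: The Hall algebra $\mathcal H(kQ)$ is the $\mathbb Q$-algebra with basis the isomorphism classes $[M]$ of finite-dimensional $kQ$-modules and product $[M][N]=\sum_{[X]}F^X_{MN}[X]$, where $F^X_{MN}=|\{Y\subseteq X: X/Y\cong M,\ Y\cong N\}|$. The composition algebra $\mathcal C(kQ)$ is the subalgebra generated by the isomorphism classes of the simple modules. *)

(* Defs.v *)
From HB Require Import structures.
From mathcomp Require Import all_boot all_order all_algebra.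
Set Implicit Arguments. Unset Strict Implicit. Unset Printing Implicit Defensive.
Import GRing.Theory.
Local Open Scope ring_scope.

Record quiver := Quiver {
  qn : nat;
  qarrow : finType;
  qsrc : qarrow -> 'I_qn;
  qtgt : qarrow -> 'I_qn }.

Definition qedge (Q : quiver) : rel 'I_(qn Q) :=
  fun i j => [exists a : qarrow Q, (qsrc a == i) && (qtgt a == j)].

(* no oriented cycle (loops included): no path from the target of an arrow
   back to its source *)
Definition acyclic (Q : quiver) : Prop :=
  forall a : qarrow Q, ~~ connect (@qedge Q) (@qtgt Q a) (@qsrc Q a).

Section Reps.
Variables (F : finFieldType) (Q : quiver).
Local Notation n := (qn Q).
Local Notation A := (qarrow Q).
Local Notation src := (@qsrc Q).
Local Notation tgt := (@qtgt Q).

(* A finite-dimensional representation (= kQ-module); vectors are row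
   vectors, the map of arrow a is v |-> v *m rmap a. *)
Record rep := Rep {
  rdim : 'I_n -> nat;
  rmap : forall a : A, 'M[F]_(rdim (src a), rdim (tgt a)) }.

Definition homT (M N : rep) :=
  {dffun forall i : 'I_n, 'M[F]_(rdim M i, rdim N i)}.

Definition is_hom (M N : rep) (phi : homT M N) : bool :=
  [forall a : A, phi (src a) *m rmap N a == rmap M a *m phi (tgt a)].

Definition iso (M N : rep) : bool :=
  [exists phi : homT M N,
     is_hom phi && [forall i, row_free (phi i) && row_full (phi i)]].

Definition repd (e : 'I_n -> nat) :=
  {dffun forall a : A, 'M[F]_(e (src a), e (tgt a))}.
Definition emb (e : 'I_n -> nat) (m : repd e) : rep := @Rep e (fun a => m a).

(* families of subspaces (canonical representatives <<U>> = U) *)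
Definition subfam (X : rep) := {dffun forall i : 'I_n, 'M[F]_(rdim X i)}.

Definition is_subrep (X : rep) (U : subfam X) : bool :=
  [forall i, <<U i>>%MS == U i] &&
  [forall a : A, (U (src a) *m rmap X a <= U (tgt a))%MS].

Definition sub_iso (X : rep) (U : subfam X) (N : rep) : bool :=
  [exists phi : homT N X,
     is_hom phi && [forall i, row_free (phi i) && (phi i == U i)%MS]].

Definition quot_iso (X : rep) (U : subfam X) (M : rep) : bool :=
  [exists psi : homT X M,
     is_hom psi && [forall i, row_full (psi i) && (kermx (psi i) == U i)%MS]].

Definition orb (e : 'I_n -> nat) (m : repd e) : nat :=
  #|[set m' : repd e | iso (emb m') (emb m)]|.

(* Hall algebra: an element is a function rep -> rat (its value at X is the
   coefficient of [X]); the basis element [M] is the indicator of the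
   isomorphism class of M. *)
Definition hall := rep -> rat.

Definition cls (M : rep) : hall := fun X => (iso X M)%:R.

(* (f * g)(X) = sum over subrepresentations Y of X of f(X/Y) g(Y);
   quotient and sub are summed over all representatives of their
   isomorphism class, normalized by the size of that class.  On basis
   elements: ([M][N])(X) = F^X_{MN}. *)
Definition hmul (f g : hall) : hall := fun X =>
  \sum_(U : subfam X | is_subrep U)
   \sum_(m : repd (fun i => rdim X i - \rank (U i))%N)
    \sum_(m' : repd (fun i => \rank (U i)))
      f (emb m) * g (emb m') *
      ((quot_iso U (emb m) && sub_iso U (emb m'))%:R /
       ((orb m)%:R * (orb m')%:R)).

Definition zero_rep : rep := @Rep (fun _ => 0%N) (fun a => 0).
Definition hone : hall := cls zero_rep.

Inductive gen_sub (S : hall -> Prop) : hall -> Prop :=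
| gen_gen h : S h -> gen_sub S h
| gen_one : gen_sub S hone
| gen_add f g : gen_sub S f -> gen_sub S g -> gen_sub S (fun X => f X + g X)
| gen_scale (c : rat) f : gen_sub S f -> gen_sub S (fun X => c * f X)
| gen_mul f g : gen_sub S f -> gen_sub S g -> gen_sub S (hmul f g)
| gen_ext f g : gen_sub S f -> (forall X, f X = g X) -> gen_sub S g.

Definition simple_rep (i : 'I_n) : rep :=
  @Rep (fun j => (j == i : nat)) (fun a => 0).

Definition indecomposable (M : rep) : Prop :=
  (exists i, 0 < rdim M i)%N /\
  ~ (exists U V : subfam M,
       [&& is_subrep U, is_subrep V, [exists i, U i != 0],
           [exists i, V i != 0] &
           [forall i, (U i :&: V i == (0 : 'M_(rdim M i)))%MS &&
                    (U i + V i == (1%:M : 'M_(rdim M i)))%MS]]).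

Definition projective (P : rep) : Prop :=
  forall (E N : rep) (g : homT E N) (h : homT P N),
    is_hom g -> (forall i, row_full (g i)) -> is_hom h ->
    exists h' : homT P E, is_hom h' /\ forall i, h i = h' i *m g i.

Definition injective (I : rep) : Prop :=
  forall (L E : rep) (f : homT L E) (u : homT L I),
    is_hom f -> (forall i, row_free (f i)) -> is_hom u ->
    exists u' : homT E I, is_hom u' /\ forall i, u i = f i *m u' i.

Definition split_epi (X N : rep) (h : homT X N) : Prop :=
  exists s : homT N X, is_hom s /\ forall i, s i *m h i = 1%:M.

Definition split_mono (L Y : rep) (u : homT L Y) : Prop :=
  exists r : homT Y L, is_hom r /\ forall i, u i *m r i = 1%:M.

Definition right_almost_split (E N : rep) (g : homT E N) : Prop :=
  ~ split_epi g /\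
  forall (X : rep) (h : homT X N), is_hom h -> ~ split_epi h ->
    exists h' : homT X E, is_hom h' /\ forall i, h i = h' i *m g i.

Definition left_almost_split (L E : rep) (f : homT L E) : Prop :=
  ~ split_mono f /\
  forall (Y : rep) (u : homT L Y), is_hom u -> ~ split_mono u ->
    exists u' : homT E Y, is_hom u' /\ forall i, u i = f i *m u' i.

(* 0 -> L -f-> E -g-> N -> 0 is an almost split (AR) sequence;
   then L = tau N and N = tau^-1 L *)
Definition almost_split (L E N : rep) (f : homT L E) (g : homT E N) : Prop :=
  [/\ is_hom f && is_hom g,
      (forall i, row_free (f i) && row_full (g i)),
      (forall i, (kermx (g i) == f i)%MS),
      left_almost_split f & right_almost_split g].

(* indecomposable preprojective: tau^-r P with P indecomposable projective *)
Inductive preproj_ind : rep -> Prop :=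
| pp_proj P : indecomposable P -> projective P -> preproj_ind P
| pp_tau L E N (f : homT L E) (g : homT E N) :
    almost_split f g -> preproj_ind L -> preproj_ind N.

(* indecomposable preinjective: tau^r I with I indecomposable injective *)
Inductive preinj_ind : rep -> Prop :=
| pi_inj I : indecomposable I -> injective I -> preinj_ind I
| pi_tau L E N (f : homT L E) (g : homT E N) :
    almost_split f g -> preinj_ind N -> preinj_ind L.

Definition is_summand (N M : rep) : Prop :=
  exists (s : homT N M) (r : homT M N),
    [/\ is_hom s, is_hom r & (forall i, s i *m r i = 1%:M)].

Definition preprojective (M : rep) : Prop :=
  forall N, indecomposable N -> is_summand N M -> preproj_ind N.
Definition preinjective (M : rep) : Prop :=
  forall N, indecomposable N -> is_summand N M -> preinj_ind N.

Definition simple_classes : hall -> Prop :=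
  fun h => exists i, h = cls (simple_rep i).
Definition preproj_classes : hall -> Prop :=
  fun h => exists M, preprojective M /\ h = cls M.
Definition preinj_classes : hall -> Prop :=
  fun h => exists M, preinjective M /\ h = cls M.

Definition composition_alg : hall -> Prop := gen_sub simple_classes.
Definition preproj_alg : hall -> Prop := gen_sub preproj_classes.
Definition preinj_alg : hall -> Prop := gen_sub preinj_classes.

End Reps.

(* Main.v *)
(* An indecomposable representation [M] with [Ext^1(M, M) = 0] is a brick
   (Happel--Ringel), hence stable for the weight
   [theta(d) = <dim M, d> - <d, dim M>], and it is the only representation [X]
   of dimension vector [dim M] all of whose subrepresentations have weight
   [<= 0]: since [<X, M> > 0] there is a nonzero map [X -> M].

   A weight defines a torsion pair [(T, F)], and unique torsion filtrations give
   [1_d = \sum_e 1^F_(d - e) * 1^T_e] in the Hall algebra, where [1_d] is the sum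
   of all classes of dimension vector [d], a product of divided powers of
   simples.  By the sign of [theta(d)] one of [1^F_d], [1^T_d] vanishes, so both
   lie in the composition algebra by induction on [d]; hence so does
   [[M] = 1^F_(dim M)].

   For an almost split sequence [0 -> L -> E -> N -> 0] one has
   [Ext^1(N, X) = 0 <-> Hom(X, L) = 0] and [Ext^1(X, L) = 0 <-> Hom(N, X) = 0].
   Hence [Ext^1(tau^-r P, tau^-s P') = 0] for [r <= s], dually for injectives, and
   the class of a direct sum of such modules, ordered by level, is a nonzero
   multiple of the product of the classes of its summands. *)

From Stdlib Require Import Classical_Prop.
Require Import Defs.
From mathcomp Require Import all_boot all_order all_algebra.
From mathcomp Require Import zify.
Set Implicit Arguments. Unset Strict Implicit. Unset Printing Implicit Defensive.
Import Order.TTheory GRing.Theory Num.Theory.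
Local Open Scope ring_scope.

(** * Morphisms, extensions, subrepresentations and quotients *)

Section LinearAlgebra.
Variable F : fieldType.

(** The rows of [A *m pinvmx A - 1%:M] lie in the kernel of [A], hence are killed by [B]; so [B]
    factors through [A]. This is dual to [mulmxKpV]. *)
Lemma mulmx_pinv_ker m n p (A : 'M[F]_(m, n)) (B : 'M_(m, p)) :
  kermx A *m B = 0 -> A *m (pinvmx A *m B) = B.
Proof.
move=> AB0; apply/eqP; rewrite mulmxA -subr_eq0 -{2}[B]mul1mx -mulmxBl.
have /submxP[D ->] : (A *m pinvmx A - 1%:M <= kermx A)%MS.
  by apply/sub_kermxP; rewrite mulmxBl mulmxKpV // mul1mx subrr.
by rewrite -mulmxA AB0 mulmx0.
Qed.

(** Used when a linear map and a correction to it fail to commute with an arrow by the same amount: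
    their difference then commutes with it. *)
Lemma sub_swap (V : zmodType) (x x' y y' : V) :
  x' - x = y' - y -> x - y = x' - y'.
Proof.
by move/eqP; rewrite subr_eq => /eqP->; rewrite addrAC (addrAC y') subrr add0r addrC.
Qed.

End LinearAlgebra.

Section Representations.
Variables (F : finFieldType) (Q : quiver).
Local Notation rep := (rep F Q).
Implicit Types X Y Z L E N M : rep.

(** Plain dependent families are easier to build than the finite functions of [homT]; [ffhom] and
    [is_homP] translate between the two. *)
Definition mor X Y := forall i, 'M[F]_(rdim X i, rdim Y i).

Definition ishom X Y (f : mor X Y) :=
  forall a, f (qsrc a) *m rmap Y a = rmap X a *m f (qtgt a).

Lemma is_homP X Y (f : homT X Y) : reflect (@ishom X Y (fun i => f i)) (is_hom f).
Proof. exact: 'forall_eqP. Qed.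

Definition ffhom X Y (f : mor X Y) : homT X Y := [ffun i => f i].

Lemma ffhomE X Y (f : mor X Y) i : ffhom f i = f i.
Proof. by rewrite ffunE. Qed.

Lemma is_hom_ff X Y (f : mor X Y) : ishom f -> is_hom (ffhom f).
Proof. by move=> hf; apply/is_homP=> a; rewrite !ffhomE. Qed.

Lemma ishom_comp X Y Z (f : mor X Y) (g : mor Y Z) :
  ishom f -> ishom g -> ishom (fun i => f i *m g i : 'M_(rdim X i, rdim Z i)).
Proof. by move=> hf hg a; rewrite -mulmxA hg !mulmxA hf. Qed.

Lemma ishom_add X Y (f g : mor X Y) :
  ishom f -> ishom g -> ishom (fun i => f i + g i).
Proof. by move=> hf hg a; rewrite mulmxDl mulmxDr hf hg. Qed.

Lemma ishom_id X : @ishom X X (fun i => 1%:M).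
Proof. by move=> a; rewrite mul1mx mulmx1. Qed.

(* [Ext^1(X, Y)] is the cokernel of the differential
   [\prod_i Hom(X_i, Y_i) -> \prod_a Hom(X_(src a), Y_(tgt a))], whose kernel
   is [Hom(X, Y)]. *)
Definition ext0 X Y :=
  forall c : (forall a, 'M[F]_(rdim X (qsrc a), rdim Y (qtgt a))),
  exists f : mor X Y,
    forall a, c a = rmap X a *m f (qtgt a) - f (qsrc a) *m rmap Y a.

Definition hom0 X Y := forall f : mor X Y, ishom f -> forall i, f i = 0.

(** Path algebras are hereditary: a cochain on [Z] extends along the monomorphism [j] to one on [X],
    and a primitive found there restricts back to [Z]. *)
Lemma ext0_sub X Y Z (j : mor Z X) :
  ishom j -> (forall i, row_free (j i)) -> ext0 X Y -> ext0 Z Y.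
Proof.
move=> hj fj eXY c.
have [f hf] := eXY (fun a => pinvmx (j (qsrc a)) *m c a).
exists (fun i => j i *m f i) => a.
by rewrite mulmxA -hj -!mulmxA -mulmxBr -hf mulmxA mulmxVp ?mul1mx.
Qed.

(** * Extensions given by a cochain, and their splittings *)

Section Extension.
Variables (N X : rep) (c : forall a, 'M[F]_(rdim N (qsrc a), rdim X (qtgt a))).

(** Vectors being rows, the block [c] carries [N] at the source into [X] at the target: [X] is the
    subrepresentation and [N] the quotient. *)
Definition extrep : rep :=
  @Rep F Q (fun i => rdim X i + rdim N i)%N
    (fun a => block_mx (rmap X a) 0 (c a) (rmap N a)).

Definition ext_inj : mor X extrep := fun i => row_mx 1%:M 0.
Definition ext_proj : mor extrep N := fun i => col_mx 0 1%:M.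

Lemma ext_inj_hom : ishom ext_inj.
Proof.
by move=> a; rewrite /= /ext_inj mul_row_block mul_mx_row !mul1mx !mul0mx !addr0
  mulmx1 mulmx0.
Qed.

Lemma ext_proj_hom : ishom ext_proj.
Proof.
by move=> a; rewrite /= /ext_proj mul_block_col mul_col_mx !mulmx0 !mulmx1 mul1mx
  mul0mx !add0r.
Qed.

Lemma ext_inj_free i : row_free (ext_inj i).
Proof.
apply/row_freeP; exists (col_mx 1%:M 0).
by rewrite mul_row_col mulmx1 mulmx0 addr0.
Qed.

Lemma ext_proj_full i : row_full (ext_proj i).
Proof.
apply/row_fullP; exists (row_mx 0 1%:M).
by rewrite mul_row_col mulmx1 mulmx0 add0r.
Qed.

Lemma ext_exact i : (kermx (ext_proj i) :=: ext_inj i)%MS.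
Proof.
apply/eqmxP/andP; split; last first.
  by apply/sub_kermxP; rewrite mul_row_col mulmx0 mul0mx addr0.
apply/rV_subP => v /sub_kermxP; rewrite -[v]hsubmxK mul_row_col mulmx0 mulmx1 add0r => ->.
by apply/submxP; exists (lsubmx v); rewrite mul_mx_row mulmx1 mulmx0.
Qed.

(** A section has the form [(f, 1)], and its compatibility with the arrows says that [c] is the
    coboundary of [f]. *)
Lemma ext_section_split (s : mor N extrep) :
  ishom s -> (forall i, s i *m ext_proj i = 1%:M) ->
  exists f : mor N X,
    forall a, c a = rmap N a *m f (qtgt a) - f (qsrc a) *m rmap X a.
Proof.
move=> hs s1; exists (fun i => lsubmx (s i)) => a.
have sE i : s i = row_mx (lsubmx (s i)) 1%:M.
  have <- : rsubmx (s i) = 1%:M by rewrite -(s1 i) -{2}[s i]hsubmxK mul_row_col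
    mulmx0 mulmx1 add0r.
  by rewrite hsubmxK.
have := hs a; rewrite [s (qsrc a)]sE [s (qtgt a)]sE /= !row_mxKl.
rewrite mul_row_block mul_mx_row !mul1mx mulmx0 => /eq_row_mx[<- _].
by rewrite addrC addKr.
Qed.

Lemma ext_retraction_split (r : mor extrep X) :
  ishom r -> (forall i, ext_inj i *m r i = 1%:M) ->
  exists f : mor N X,
    forall a, c a = rmap N a *m f (qtgt a) - f (qsrc a) *m rmap X a.
Proof.
(* A retraction is a column with blocks [1] and [f']; compatibility makes [c] the coboundary of
   [- f'], whence the sign. *)
move=> hr r1; exists (fun i => - dsubmx (r i)) => a.
have rE i : r i = col_mx 1%:M (dsubmx (r i)).
  have <- : usubmx (r i) = 1%:M by rewrite -(r1 i) -{2}[r i]vsubmxK mul_row_col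
    mul0mx mul1mx addr0.
  by rewrite vsubmxK.
have := hr a; rewrite [r (qsrc a)]rE [r (qtgt a)]rE /= !col_mxKd.
rewrite mul_block_col mul_col_mx !mulmx1 mul1mx mul0mx addr0 => /eq_col_mx[_ e].
by rewrite mulmxN mulNmx opprK e addrC addrK.
Qed.

End Extension.

(** Lifting the identity of [P] along [ext_proj] splits the extension attached to any cochain. *)
Lemma projective_ext0 P X : projective P -> ext0 P X.
Proof.
move=> projP c.
have [|i||h []] := projP (extrep c) P (ffhom (ext_proj c)) (ffhom (fun=> 1%:M)).
- exact/is_hom_ff/ext_proj_hom.
- by rewrite ffhomE ext_proj_full.
- exact/is_hom_ff/ishom_id.
move=> /is_homP hh h1; apply: (ext_section_split hh) => i.
by have := h1 i; rewrite !ffhomE => <-.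
Qed.

Lemma injective_ext0 I X : Defs.injective I -> ext0 X I.
Proof.
move=> injI c.
have [|i||h []] := injI I (extrep c) (ffhom (ext_inj c)) (ffhom (fun=> 1%:M)).
- exact/is_hom_ff/ext_inj_hom.
- by rewrite ffhomE ext_inj_free.
- exact/is_hom_ff/ishom_id.
move=> /is_homP hh h1; apply: (ext_retraction_split hh) => i.
by have := h1 i; rewrite !ffhomE => <-.
Qed.

(** * Subrepresentations and quotients in coordinates *)

Section SubQuotient.
Variables (X : rep) (m : 'I_(qn Q) -> nat).
Variable U : forall i, 'M[F]_(m i, rdim X i).
Arguments U : clear implicits.

(** The matrices [U i] may have any number of rows, so kernels and images are treated alike;
    [row_base] supplies coordinates on the row spaces. *)
Definition srep : rep :=
  @Rep F Q (fun i => \rank (U i)) (fun a =>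
    row_base (U (qsrc a)) *m rmap X a *m pinvmx (row_base (U (qtgt a)))).
Definition sinc : mor srep X := fun i => row_base (U i).

Definition stable := forall a, (U (qsrc a) *m rmap X a <= U (qtgt a))%MS.

Lemma sinc_hom : stable -> ishom sinc.
Proof.
move=> sU a; rewrite /= mulmxKpV // eq_row_base.
by rewrite (submx_trans _ (sU a)) ?submxMr ?eq_row_base.
Qed.

Lemma sinc_free i : row_free (sinc i). Proof. exact: row_base_free. Qed.

Lemma sinc_eq i : (sinc i :=: U i)%MS. Proof. exact: eq_row_base. Qed.

End SubQuotient.

Section Cokernel.
Variables (X : rep) (m : 'I_(qn Q) -> nat).
Variable U : forall i, 'M[F]_(m i, rdim X i).

(** The cast gives the quotient the literal dimension [rdim X i - \rank (U i)] over which [hmul]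
    sums. *)
Definition qbase i : 'M[F]_(rdim X i, rdim X i - \rank (U i)) :=
  castmx (erefl, mxrank_coker (U i)) (col_base (cokermx (U i))).

Lemma qbase_full i : row_full (qbase i).
Proof.
rewrite /qbase; move: (mxrank_coker _) => e.
by case: _ / e; rewrite castmx_id col_base_full.
Qed.

Lemma qbase_ker i : (kermx (qbase i) :=: U i)%MS.
Proof.
apply: (@eqmx_trans _ _ _ _ _ _ (kermx (cokermx (U i)))).
  rewrite /qbase; move: (mxrank_coker _) => e; case: _ / e; rewrite castmx_id.
  apply/eqmxP/andP; split; apply/sub_kermxP.
    by rewrite -[X in _ *m X]mulmx_base mulmxA mulmx_ker mul0mx.
  apply: (row_free_inj (row_base_free (cokermx (U i)))).
  by rewrite -mulmxA mulmx_base mulmx_ker mul0mx.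
apply/eqmxP/andP; split; last by apply/sub_kermxP; rewrite mulmx_coker.
by rewrite submxE mulmx_ker.
Qed.

Definition qrep : rep :=
  @Rep F Q (fun i => rdim X i - \rank (U i))%N (fun a =>
    pinvmx (qbase (qsrc a)) *m rmap X a *m qbase (qtgt a)).
Definition qproj : mor X qrep := qbase.

Lemma qproj_hom : stable U -> ishom qproj.
Proof.
move=> sU a; rewrite /= -[in LHS]mulmxA mulmx_pinv_ker //.
apply/eqP; rewrite mulmxA -sub_kermx /qproj qbase_ker.
by rewrite (submx_trans _ (sU a)) // submxMr // qbase_ker.
Qed.

End Cokernel.
End Representations.

(** * Almost split sequences *)

Section AlmostSplit.
Variables (F : finFieldType) (Q : quiver).
Local Notation rep := (rep F Q).
Variables (L E N : rep) (f : homT L E) (g : homT E N).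
Hypothesis fg_as : almost_split f g.

Let hf a : f (qsrc a) *m rmap E a = rmap L a *m f (qtgt a).
Proof. by case: fg_as => /andP[/is_homP/(_ a)]. Qed.

Let hg a : g (qsrc a) *m rmap N a = rmap E a *m g (qtgt a).
Proof. by case: fg_as => /andP[_ /is_homP/(_ a)]. Qed.

Let ff i : row_free (f i).
Proof. by case: fg_as => _ /(_ i)/andP[]. Qed.

Let gf i : row_full (g i).
Proof. by case: fg_as => _ /(_ i)/andP[]. Qed.

Let kerg i m (A : 'M_(m, _)) : A *m g i = 0 -> A *m pinvmx (f i) *m f i = A.
Proof.
case: fg_as => _ _ /(_ i)/eqmxP kgf _ _ Ag0.
by rewrite mulmxKpV // -kgf; apply/sub_kermxP.
Qed.

Let fg0 i : f i *m g i = 0.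
Proof. by case: fg_as => _ _ /(_ i)/eqmxP kgf _ _; apply/sub_kermxP; rewrite kgf. Qed.

Let cokf i m (A : 'M_(_, m)) : f i *m A = 0 -> g i *m (pinvmx (g i) *m A) = A.
Proof.
case: fg_as => _ _ /(_ i)/eqmxP kgf _ _ fA0; apply: mulmx_pinv_ker.
have /submxP[D ->] : (kermx (g i) <= f i)%MS by rewrite kgf.
by rewrite -mulmxA fA0 mulmx0.
Qed.

Let no_section (s : mor N E) : ishom s -> ~ (forall i, s i *m g i = 1%:M).
Proof.
case: fg_as => _ _ _ _ [nsplit _] hs s1; apply: nsplit.
by exists (ffhom s); split=> [|i]; [exact: is_hom_ff | rewrite ffhomE].
Qed.

Let no_retraction (r : mor E L) : ishom r -> ~ (forall i, f i *m r i = 1%:M).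
Proof.
case: fg_as => _ _ _ [nsplit _] _ hr r1; apply: nsplit.
by exists (ffhom r); split=> [|i]; [exact: is_hom_ff | rewrite ffhomE].
Qed.

Let lift_or_split X (h : mor X N) : ishom h ->
  (exists s : mor N X, ishom s /\ forall i, s i *m h i = 1%:M) \/
  (exists k : mor X E, ishom k /\ forall i, h i = k i *m g i).
Proof.
move=> hh; have [[s [/is_homP hs s1]]|nsplit] := classic (split_epi (ffhom h)).
  by left; exists (fun i => s i); split=> // i; rewrite -(s1 i) ffhomE.
right; case: fg_as => _ _ _ _ [_ lift].
have [k [/is_homP hk kE]] := lift X (ffhom h) (is_hom_ff hh) nsplit.
by exists (fun i => k i); split=> // i; rewrite -kE ffhomE.
Qed.

Let extend_or_split X (h : mor L X) : ishom h ->
  (exists r : mor X L, ishom r /\ forall i, h i *m r i = 1%:M) \/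
  (exists k : mor E X, ishom k /\ forall i, h i = f i *m k i).
Proof.
move=> hh; have [[s [/is_homP hs s1]]|nsplit] := classic (split_mono (ffhom h)).
  by left; exists (fun i => s i); split=> // i; rewrite -(s1 i) ffhomE.
right; case: fg_as => _ _ _ [_ ext] _.
have [k [/is_homP hk kE]] := ext X (ffhom h) (is_hom_ff hh) nsplit.
by exists (fun i => k i); split=> // i; rewrite -kE ffhomE.
Qed.

(** Unless the extension of [N] by [X] attached to [c] splits, its projection lifts to a map [k]
    into [E]. This [k] sends [X] into [L], hence to zero, and so descends to a section of [g], which
    is impossible. *)
Lemma as_hom0_ext0r X : hom0 X L -> ext0 N X.
Proof.
move=> XL0 c.
have [[s [hs s1]]|[k [hk kE]]] := lift_or_split (ext_proj_hom c).
  exact: ext_section_split hs s1.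
have kg i : usubmx (k i) *m g i = 0.
  have := kE i; rewrite -{1}[k i]vsubmxK mul_col_mx /ext_proj.
  by case/eq_col_mx => <-.
have [u uf] : exists u : mor X L, forall i, u i *m f i = usubmx (k i).
  by exists (fun i => usubmx (k i) *m pinvmx (f i)) => i; rewrite kerg.
have hku a : usubmx (k (qsrc a)) *m rmap E a = rmap X a *m usubmx (k (qtgt a)).
  have := hk a; rewrite /= -{1}[k (qsrc a)]vsubmxK -{1}[k (qtgt a)]vsubmxK.
  by rewrite mul_block_col mul_col_mx mul0mx addr0 => /eq_col_mx[].
have hu : ishom u.
  move=> a; apply: (row_free_inj (ff (qtgt a))).
  by rewrite -mulmxA -hf mulmxA uf hku -uf mulmxA.
have k0 i : usubmx (k i) = 0 by rewrite -uf (XL0 u hu) mul0mx.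
case: (@no_section (fun i => dsubmx (k i))).
  move=> a; have := hk a; rewrite /= -{1}[k (qsrc a)]vsubmxK -{1}[k (qtgt a)]vsubmxK.
  by rewrite mul_block_col mul_col_mx !k0 !mulmx0 ?add0r => /eq_col_mx[].
move=> i; have := kE i; rewrite -{1}[k i]vsubmxK mul_col_mx /ext_proj.
by case/eq_col_mx.
Qed.

(** Dually, unless the extension of [X] by [L] splits, the inclusion of [L] extends to a map [k] on
    [E]; its component in [X] factors through [N], hence is zero, and [k] becomes a retraction of
    [f]. *)
Lemma as_hom0_ext0l X : hom0 N X -> ext0 X L.
Proof.
move=> NX0 c.
have [[r [hr r1]]|[k [hk kE]]] := extend_or_split (ext_inj_hom c).
  exact: ext_retraction_split hr r1.
have fk i : f i *m rsubmx (k i) = 0.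
  have := kE i; rewrite -{1}[k i]hsubmxK mul_mx_row /ext_inj.
  by case/eq_row_mx => _ <-.
have [v gv] : exists v : mor N X, forall i, g i *m v i = rsubmx (k i).
  by exists (fun i => pinvmx (g i) *m rsubmx (k i)) => i; rewrite cokf.
have hkv a : rsubmx (k (qsrc a)) *m rmap X a = rmap E a *m rsubmx (k (qtgt a)).
  have := hk a; rewrite /= -{1}[k (qsrc a)]hsubmxK -{1}[k (qtgt a)]hsubmxK.
  by rewrite mul_row_block mul_mx_row mulmx0 add0r => /eq_row_mx[].
have hv : ishom v.
  move=> a; apply: (row_full_inj (gf (qsrc a))).
  by rewrite mulmxA gv hkv -gv !mulmxA hg.
have k0 i : rsubmx (k i) = 0 by rewrite -gv (NX0 v hv) mulmx0.
case: (@no_retraction (fun i => lsubmx (k i))).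
  move=> a; have := hk a; rewrite /= -{1}[k (qsrc a)]hsubmxK -{1}[k (qtgt a)]hsubmxK.
  by rewrite mul_row_block mul_mx_row !k0 !mul0mx ?addr0 => /eq_row_mx[].
move=> i; have := kE i; rewrite -{1}[k i]hsubmxK mul_mx_row /ext_inj.
by case/eq_row_mx.
Qed.

(** If [h] is nonzero, the inclusion of its kernel [K] into [N] is not a split epimorphism, so it
    lifts to [E]. The obstruction to splitting [g] then comes from a cochain of [X] in [L], which is
    a coboundary; so [g] would split. *)
Lemma as_ext0_hom0l X : ext0 X L -> hom0 N X.
Proof.
move=> eXL h hh i0; pose K i := kermx (h i).
have sK : stable K.
  by move=> a; apply/sub_kermxP; rewrite -mulmxA -hh mulmxA mulmx_ker mul0mx.
have Kh i : sinc K i *m h i = 0 by apply/sub_kermxP; rewrite sinc_eq.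
have [[s [hs s1]]|[k [hk kE]]] := lift_or_split (sinc_hom sK).
  by rewrite -[LHS]mul1mx -s1 -mulmxA Kh mulmx0.
(* The linear section [s] of [g] is chosen to agree on [K] with the lift [k]. *)
have [s sg Ks] : exists2 s : mor N E, forall i, s i *m g i = 1%:M
                              & forall i, sinc K i *m s i = k i.
  pose w i := (sinc K i *m pinvmx (g i) - k i) *m pinvmx (f i).
  have wf i : w i *m f i = sinc K i *m pinvmx (g i) - k i.
    by apply: kerg; rewrite mulmxBl -mulmxA mulVpmx // mulmx1 -kE subrr.
  exists (fun i => pinvmx (g i) - pinvmx (sinc K i) *m (w i *m f i)) => i.
    by rewrite mulmxBl mulVpmx // -mulmxA -[w i *m _ *m _]mulmxA fg0 !mulmx0 subr0.
  by rewrite mulmxBr wf [_ *m (pinvmx (sinc K i) *m _)]mulmxA mulmxVp ?sinc_free //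
    mul1mx subKr.
pose d a := rmap N a *m s (qtgt a) - s (qsrc a) *m rmap E a.
pose c a := d a *m pinvmx (f (qtgt a)).
have cf a : c a *m f (qtgt a) = d a.
  by apply: kerg; rewrite mulmxBl -!mulmxA sg -hg [s _ *m (_ *m _)]mulmxA sg mulmx1 mul1mx subrr.
(* On [K] the section [s] commutes with the arrows, so [c] vanishes there and factors through
   [h]. *)
have Kc a : kermx (h (qsrc a)) *m c a = 0.
  apply/eqP; rewrite -sub_kermx -(sinc_eq K) sub_kermx; apply/eqP.
  apply: (row_free_inj (ff (qtgt a))); rewrite mul0mx -mulmxA cf mulmxBr !mulmxA.
  by rewrite (sinc_hom sK) -[_ *m sinc K _ *m _]mulmxA !Ks hk subrr.
have [p pE] := eXL (fun a => pinvmx (h (qsrc a)) *m c a).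
case: (@no_section (fun i => s i - h i *m p i *m f i)); last first.
  by move=> i; rewrite mulmxBl sg -[_ *m f _ *m _]mulmxA fg0 mulmx0 subr0.
move=> a; rewrite mulmxBl mulmxBr; apply: sub_swap.
rewrite -[LHS]cf -(mulmx_pinv_ker (Kc a)) pE mulmxBr mulmxBl !mulmxA hh.
by rewrite -![_ *m f _ *m _]mulmxA hf !mulmxA.
Qed.

(** Dual argument with the cokernel of [h]: the projection of [L] onto it extends to [E]. A linear
    retraction of [f] compatible with this extension has its defect in the image of [h], and the
    defect lifts to a cochain of [N] in [X]. *)
Lemma as_ext0_hom0r X : ext0 N X -> hom0 X L.
Proof.
move=> eNX h hh i0; have sI : stable h.
  by move=> a; rewrite hh submxMl.
have hq i : h i *m qproj h i = 0 by apply/sub_kermxP; rewrite qbase_ker.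
have [[r [hr r1]]|[k [hk kE]]] := extend_or_split (qproj_hom sI).
  by rewrite -[LHS]mulmx1 -r1 mulmxA hq mul0mx.
have [r fr rq] : exists2 r : mor E L, forall i, f i *m r i = 1%:M
                              & forall i, r i *m qproj h i = k i.
  pose w i := pinvmx (g i) *m (pinvmx (f i) *m qproj h i - k i).
  have gw i : g i *m w i = pinvmx (f i) *m qproj h i - k i.
    by apply: cokf; rewrite mulmxBr mulmxA mulmxVp // mul1mx -kE subrr.
  exists (fun i => pinvmx (f i) - g i *m w i *m pinvmx (qproj h i)) => i.
    by rewrite mulmxBr mulmxVp // mulmxA [f i *m (_ *m _)]mulmxA fg0 !mul0mx subr0.
  by rewrite mulmxBl gw -[_ *m pinvmx (qproj h i) *m _]mulmxA mulVpmx ?qbase_full //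
    mulmx1 subKr.
pose d a := rmap E a *m r (qtgt a) - r (qsrc a) *m rmap L a.
pose c a := pinvmx (g (qsrc a)) *m d a.
have gc a : g (qsrc a) *m c a = d a.
  by apply: cokf; rewrite mulmxBr !mulmxA hf fr -[rmap L a *m _ *m _]mulmxA fr mulmx1 mul1mx subrr.
have cq a : (c a <= h (qtgt a))%MS.
  rewrite -(qbase_ker h) sub_kermx; apply/eqP.
  apply: (row_full_inj (gf (qsrc a))); rewrite mulmx0 mulmxA gc mulmxBl -!mulmxA.
  by rewrite -(qproj_hom sI) [r _ *m (_ *m _)]mulmxA !rq hk subrr.
have [p pE] := eNX (fun a => c a *m pinvmx (h (qtgt a))).
case: (@no_retraction (fun i => r i - g i *m p i *m h i)); last first.
  by move=> i; rewrite mulmxBr fr !mulmxA fg0 !mul0mx subr0.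
move=> a; rewrite mulmxBl mulmxBr; apply: sub_swap.
rewrite -[LHS]gc -(mulmxKpV (cq a)) pE mulmxBl mulmxBr !mulmxA hg.
by rewrite -![_ *m h _ *m _]mulmxA hh !mulmxA.
Qed.

End AlmostSplit.

(** * Preprojective and preinjective levels *)

Section Levels.
Variables (F : finFieldType) (Q : quiver).
Local Notation rep := (rep F Q).
Implicit Types L E M N : rep.

(** Records the exponent [r] in [tau^-r P], so that two preprojectives can be compared. *)
Inductive preproj_level : nat -> rep -> Prop :=
| preproj_level0 P : projective P -> preproj_level 0 P
| preproj_levelS r L E N (f : homT L E) (g : homT E N) :
    almost_split f g -> preproj_level r L -> preproj_level r.+1 N.

Inductive preinj_level : nat -> rep -> Prop :=
| preinj_level0 I : Defs.injective I -> preinj_level 0 I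
| preinj_levelS r L E N (f : homT L E) (g : homT E N) :
    almost_split f g -> preinj_level r N -> preinj_level r.+1 L.

Lemma preproj_ind_level N : preproj_ind N -> exists r, preproj_level r N.
Proof.
elim=> [P _ projP | L E N' f g as_fg _ [r rL]]; first by exists 0; apply: preproj_level0.
by exists r.+1; apply: preproj_levelS as_fg rL.
Qed.

Lemma preinj_ind_level N : preinj_ind N -> exists r, preinj_level r N.
Proof.
elim=> [P _ injP | L E N' f g as_fg _ [r rL]]; first by exists 0; apply: preinj_level0.
by exists r.+1; apply: preinj_levelS as_fg rL.
Qed.

(** Both modules are translated back together: with [M = tau^-1 L] and [N = tau^-1 L'],
    [Hom(L', L) = 0] gives [Ext^1(M, L') = 0], which gives [Hom(N, M) = 0]. The descent ends when
    [M] is projective, where [Ext^1(M, L') = 0] outright. *)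
Lemma preproj_level_hom0 r s M N :
  preproj_level r M -> preproj_level s N -> (r < s)%N -> hom0 N M.
Proof.
move=> rM; elim: rM s N => {r M} [P projP | r L E M f g as_fg _ IH] s N [] //.
  move=> {}s L E N' f g as_fg _ _.
  exact: (as_ext0_hom0l as_fg (projective_ext0 projP)).
move=> {}s L' E' N' f' g' as_fg' sL' lt_rs.
apply: (as_ext0_hom0l as_fg'); apply: (as_hom0_ext0r as_fg); exact: IH sL' lt_rs.
Qed.

(** For [M = tau^-1 L], the level of [L] is strictly below that of [N], so [Hom(N, L) = 0] and
    almost split duality applies. *)
Lemma preproj_level_ext0 r s M N :
  preproj_level r M -> preproj_level s N -> (r <= s)%N -> ext0 M N.
Proof.
case=> {r M} [P projP _ _ | r L E M f g as_fg rL sN lt_rs].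
  exact: projective_ext0.
exact: (as_hom0_ext0r as_fg (preproj_level_hom0 rL sN lt_rs)).
Qed.

Lemma preinj_level_hom0 r s M N :
  preinj_level r N -> preinj_level s M -> (r < s)%N -> hom0 N M.
Proof.
move=> rN; elim: rN s M => {r N} [I injI | r L E N f g as_fg _ IH] s M [] //.
  move=> {}s L E N' f g as_fg _ _.
  exact: (as_ext0_hom0r as_fg (injective_ext0 injI)).
move=> {}s L' E' N' f' g' as_fg' sL' lt_rs.
apply: (as_ext0_hom0r as_fg'); apply: (as_hom0_ext0l as_fg); exact: IH sL' lt_rs.
Qed.

Lemma preinj_level_ext0 r s M N :
  preinj_level r N -> preinj_level s M -> (r <= s)%N -> ext0 M N.
Proof.
case=> {r N} [I injI _ _ | r L E N f g as_fg rN sM lt_rs].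
  exact: injective_ext0.
exact: (as_hom0_ext0l as_fg (preinj_level_hom0 rN sM lt_rs)).
Qed.

End Levels.

(** * Biproducts *)

Section Biproducts.
Variables (F : finFieldType) (Q : quiver).
Local Notation rep := (rep F Q).
Implicit Types A B M N X Y : rep.

Lemma isoP X Y :
  reflect (exists (f : mor X Y) (g : mor Y X), [/\ ishom f, ishom g,
             forall i, f i *m g i = 1%:M & forall i, g i *m f i = 1%:M])
          (iso X Y).
Proof.
apply: (iffP existsP) => [[f /andP[/is_homP hf /forallP ff]] | [f [g [hf _ fg gf]]]].
  exists (fun i => f i), (fun i => pinvmx (f i)).
  have fg i : f i *m pinvmx (f i) = 1%:M by rewrite mulmxVp //; case/andP: (ff i).
  have gf i : pinvmx (f i) *m f i = 1%:M by rewrite mulVpmx //; case/andP: (ff i).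
  split=> // a.
  rewrite -[LHS]mulmx1 -(fg (qtgt a)) mulmxA -[_ *m rmap X a *m _]mulmxA.
  by rewrite -hf mulmxA gf mul1mx.
exists (ffhom f); rewrite is_hom_ff //=; apply/forallP=> i; rewrite ffhomE.
by apply/andP; split; [apply/row_freeP | apply/row_fullP]; exists (g i).
Qed.

Lemma iso_sym X Y : iso X Y = iso Y X.
Proof. by apply/isoP/isoP => -[f [g []]]; exists g, f. Qed.

Lemma iso_trans X Y Z : iso X Y -> iso Y Z -> iso X Z.
Proof.
move=> /isoP[f [g [hf hg fg gf]]] /isoP[f' [g' [hf' hg' fg' gf']]].
apply/isoP; exists (fun i => f i *m f' i), (fun i => g' i *m g i).
split; try exact: ishom_comp.
- by move=> i; rewrite mulmxA -(mulmxA (f i)) fg' mulmx1.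
- by move=> i; rewrite mulmxA -(mulmxA (g' i)) gf mulmx1.
Qed.

Lemma iso_dim X Y i : iso X Y -> rdim X i = rdim Y i.
Proof.
move=> /existsP[f /andP[_ /forallP/(_ i)/andP[/eqP e /eqP e']]].
by rewrite -e -[RHS]e'.
Qed.

(** Inclusions and projections describe a direct sum up to isomorphism, without choosing block
    matrices. *)
Definition biprod X A B :=
  exists (sA : mor A X) (rA : mor X A) (sB : mor B X) (rB : mor X B),
    [/\ ishom sA, ishom rA, ishom sB & ishom rB] /\
    forall i, [/\ sA i *m rA i = 1%:M, sB i *m rB i = 1%:M,
                  sA i *m rB i = 0, sB i *m rA i = 0 &
                  rA i *m sA i + rB i *m sB i = 1%:M].

Lemma biprod_sym X A B : biprod X A B -> biprod X B A.
Proof.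
move=> [sA [rA [sB [rB [[? ? ? ?] h]]]]]; exists sB, rB, sA, rA; split=> // i.
by have [? ? ? ? e] := h i; split=> //; rewrite addrC.
Qed.

Lemma biprod_dim X A B i : biprod X A B -> rdim X i = (rdim A i + rdim B i)%N.
Proof.
move=> [sA [rA [sB [rB [_ /(_ i)[AA BB AB BA e]]]]]].
have h1 : col_mx (sA i) (sB i) *m row_mx (rA i) (rB i) = 1%:M.
  by rewrite mul_col_row AA BB AB BA -scalar_mx_block.
have h2 : row_mx (rA i) (rB i) *m col_mx (sA i) (sB i) = 1%:M.
  by rewrite mul_row_col.
have /eqP f1 : row_free (col_mx (sA i) (sB i)) by apply/row_freeP; eexists; exact: h1.
have /eqP f2 : row_full (col_mx (sA i) (sB i)) by apply/row_fullP; eexists; exact: h2.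
by rewrite -f1 -[LHS]f2.
Qed.

Lemma biprod_iso X Y A B : biprod X A B -> biprod Y A B -> iso X Y.
Proof.
move=> [sA [rA [sB [rB [[hsA hrA hsB hrB] h]]]]].
move=> [tA [qA [tB [qB [[htA hqA htB hqB] k]]]]].
apply/isoP; exists (fun i => rA i *m tA i + rB i *m tB i),
                   (fun i => qA i *m sA i + qB i *m sB i); split.
- by apply: ishom_add; apply: ishom_comp.
- by apply: ishom_add; apply: ishom_comp.
- move=> i; have [AA BB AB BA e] := h i; have [AA' BB' AB' BA' e'] := k i.
  rewrite mulmxDl !mulmxDr !mulmxA -!(mulmxA (rA i)) -!(mulmxA (rB i)).
  by rewrite AA' BB' AB' BA' !(mul0mx, mulmx0, mul1mx, mulmx1, add0r, addr0).
- move=> i; have [AA BB AB BA e] := h i; have [AA' BB' AB' BA' e'] := k i.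
  rewrite mulmxDl !mulmxDr !mulmxA -!(mulmxA (qA i)) -!(mulmxA (qB i)).
  by rewrite AA BB AB BA !(mul0mx, mulmx0, mul1mx, mulmx1, add0r, addr0).
Qed.

(** The failure of a linear section of [p] to be a morphism takes values in [B]; as a cochain of [A]
    in [B] it is a coboundary, and subtracting a primitive gives a splitting. *)
Lemma ext0_biprod X A B (j : mor B X) (p : mor X A) :
  ishom j -> ishom p -> (forall i, row_free (j i)) -> (forall i, row_full (p i)) ->
  (forall i, (kermx (p i) :=: j i)%MS) -> ext0 A B -> biprod X A B.
Proof.
move=> hj hp fj fp kpj eAB.
have jp i : j i *m p i = 0 by apply/sub_kermxP; rewrite kpj.
have kerp i m (C : 'M_(m, _)) : C *m p i = 0 -> C *m pinvmx (j i) *m j i = C.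
  by move=> Cp; rewrite mulmxKpV // -kpj; apply/sub_kermxP.
have [s0 s0p] : exists s0 : mor A X, forall i, s0 i *m p i = 1%:M.
  by exists (fun i => pinvmx (p i)) => i; rewrite mulVpmx.
pose d a := rmap A a *m s0 (qtgt a) - s0 (qsrc a) *m rmap X a.
pose c a := d a *m pinvmx (j (qtgt a)).
have cj a : c a *m j (qtgt a) = d a.
  by apply: kerp; rewrite mulmxBl -!mulmxA s0p -hp [s0 _ *m (_ *m _)]mulmxA s0p
    mulmx1 mul1mx subrr.
have [t tE] := eAB c.
have [s hs sp] : exists2 s : mor A X, ishom s & forall i, s i *m p i = 1%:M.
  exists (fun i => s0 i - t i *m j i); last first.
    by move=> i; rewrite mulmxBl s0p -[_ *m j _ *m _]mulmxA jp mulmx0 subr0.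
  move=> a; rewrite mulmxBl mulmxBr; apply: sub_swap.
  by rewrite -[LHS]cj tE mulmxBl !mulmxA -![_ *m j _ *m _]mulmxA hj !mulmxA.
have [r rj] : exists r : mor X B, forall i, r i *m j i = 1%:M - p i *m s i.
  exists (fun i => (1%:M - p i *m s i) *m pinvmx (j i)) => i.
  by apply: kerp; rewrite mulmxBl mul1mx -mulmxA sp mulmx1 subrr.
exists s, p, j, r; split.
  split=> // a; apply: (row_free_inj (fj (qtgt a))).
  rewrite -[r _ *m _ *m _]mulmxA -[_ *m r _ *m _]mulmxA rj -hj mulmxA rj mulmxBl mulmxBr mul1mx mulmx1.
  by rewrite -mulmxA hs !mulmxA hp.
move=> i; split=> //.
- apply: (row_free_inj (fj i)).
  by rewrite -mulmxA rj mulmxBr mulmx1 mulmxA jp mul0mx subr0 mul1mx.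
- apply: (row_free_inj (fj i)).
  by rewrite -mulmxA rj mulmxBr mulmx1 mulmxA sp mul1mx subrr mul0mx.
- by rewrite rj addrC subrK.
Qed.

Lemma biprod_summandl X A B : biprod X A B -> is_summand A X.
Proof.
move=> [sA [rA [sB [rB [[? ? ? ?] h]]]]]; exists (ffhom sA), (ffhom rA).
by split; [exact: is_hom_ff | exact: is_hom_ff | move=> i; rewrite !ffhomE; case: (h i)].
Qed.

Lemma summand_trans A B C : is_summand A B -> is_summand B C -> is_summand A C.
Proof.
move=> [s [r [/is_homP hs /is_homP hr sr]]] [s' [r' [/is_homP hs' /is_homP hr' sr']]].
exists (ffhom (fun i => s i *m s' i)), (ffhom (fun i => r' i *m r i)); split.
- by apply: is_hom_ff; apply: ishom_comp hs hs'.
- by apply: is_hom_ff; apply: ishom_comp hr' hr.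
- by move=> i; rewrite !ffhomE mulmxA -(mulmxA (s i)) sr' mulmx1.
Qed.

Lemma summand_biprod A X : is_summand A X -> exists B, biprod X A B.
Proof.
move=> [s [r [/is_homP hs /is_homP hr sr]]].
pose K i := kermx (r i).
have sK : stable K.
  by move=> a; apply/sub_kermxP; rewrite -mulmxA -hr mulmxA mulmx_ker mul0mx.
have Kr i : sinc K i *m r i = 0 by apply/sub_kermxP; rewrite sinc_eq.
have [q qK] : exists q : mor X (srep K),
    forall i, q i *m sinc K i = 1%:M - r i *m s i.
  exists (fun i => (1%:M - r i *m s i) *m pinvmx (sinc K i)) => i.
  rewrite mulmxKpV // sinc_eq; apply/sub_kermxP.
  by rewrite mulmxBl mul1mx -mulmxA sr mulmx1 subrr.
exists (srep K), (fun i => s i), (fun i => r i), (sinc K), q; split.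
  split=> //; first exact: sinc_hom.
  move=> a; apply: (row_free_inj (sinc_free K (qtgt a))).
  rewrite -[q _ *m _ *m _]mulmxA -[_ *m q _ *m _]mulmxA qK -(sinc_hom sK) mulmxA qK mulmxBl mulmxBr mul1mx mulmx1.
  by rewrite -mulmxA hs !mulmxA hr.
move=> i; split=> //.
- apply: (row_free_inj (sinc_free K i)).
  by rewrite -mulmxA qK mulmxBr mulmx1 mulmxA Kr mul0mx subr0 mul1mx.
- apply: (row_free_inj (sinc_free K i)).
  by rewrite -mulmxA qK mulmxBr mulmx1 mulmxA sr mul1mx subrr mul0mx.
- by rewrite qK addrC subrK.
Qed.

(** The projection onto [U] along [V] commutes with the arrows because both families are stable. *)
Lemma complement_summand X (U V : forall i, 'M[F]_(rdim X i)) :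
  stable U -> stable V -> (forall i, (U i :&: V i)%MS = 0) ->
  (forall i, (1%:M <= U i + V i)%MS) -> is_summand (srep U) X.
Proof.
move=> sU sV UV0 UV1; pose P i := proj_mx (U i) (V i).
have PU i : (P i <= U i)%MS by rewrite -[P i]mul1mx proj_mx_sub.
have PV i : (1%:M - P i <= V i)%MS by rewrite -[P i]mul1mx proj_mx_compl_sub.
have PP a : P (qsrc a) *m rmap X a = rmap X a *m P (qtgt a).
  have e1 : P (qsrc a) *m rmap X a *m P (qtgt a) = P (qsrc a) *m rmap X a.
    apply: proj_mx_id; first exact: UV0.
    exact: submx_trans (submxMr _ (PU _)) (sU a).
  have e2 : (1%:M - P (qsrc a)) *m rmap X a *m P (qtgt a) = 0.
    apply: proj_mx_0; first exact: UV0.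
    exact: submx_trans (submxMr _ (PV _)) (sV a).
  by apply/eqP; rewrite -subr_eq0 -oppr_eq0 opprB -{1}e1 -mulmxBl -{1}[rmap X a]mul1mx
    -mulmxBl e2.
have [r rE] : exists r : mor X (srep U), forall i, r i *m sinc U i = P i.
  by exists (fun i => P i *m pinvmx (sinc U i)) => i; rewrite mulmxKpV // sinc_eq.
exists (ffhom (sinc U)), (ffhom r); split.
- exact/is_hom_ff/sinc_hom.
- apply: is_hom_ff => a; apply: (row_free_inj (sinc_free U (qtgt a))).
  by rewrite -[r _ *m _ *m _]mulmxA -[_ *m r _ *m _]mulmxA rE -(sinc_hom sU) mulmxA rE.
move=> i; rewrite !ffhomE; apply: (row_free_inj (sinc_free U i)).
by rewrite -mulmxA rE mul1mx proj_mx_id // sinc_eq.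
Qed.

Lemma not_indecomposable_biprod X :
  (exists i, 0 < rdim X i)%N -> ~ indecomposable X ->
  exists A B, [/\ biprod X A B, (exists i, 0 < rdim A i)%N & (exists i, 0 < rdim B i)%N].
Proof.
move=> X0 nindX; have := NNPP _ (fun nUV => nindX (conj X0 nUV)).
move=> [U [V /and5P[/andP[_ /forallP sU] /andP[_ /forallP sV] /existsP[i Ui]
               /existsP[j Vj] /forallP UV]]].
have UV0 k : (U k :&: V k)%MS = 0.
  by apply/eqP; case/andP: (UV k) => /eqmxP e _; rewrite -submx0 e.
have UV1 k : (1%:M <= U k + V k)%MS by case/andP: (UV k) => _ /eqmxP e; rewrite e.
have [B XB] := summand_biprod (@complement_summand X (fun i => U i) (fun i => V i) sU sV UV0 UV1).
exists (srep (fun i => U i)), B; split=> //; first by exists i; rewrite lt0n mxrank_eq0.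
exists j; rewrite -(ltn_add2l (\rank (U j))) addn0 -(biprod_dim j XB).
have /eqP e : row_full (U j + V j)%MS by rewrite -sub1mx.
by rewrite -[X in (_ < X)%N]e (mxrank_disjoint_sum (UV0 j)) -addn1 leq_add2l lt0n mxrank_eq0.
Qed.

End Biproducts.

(** * Rigid indecomposables are bricks *)

Section Bricks.
Variables (F : finFieldType) (Q : quiver).
Local Notation rep := (rep F Q).
Implicit Types M X Y : rep.

(** Otherwise the images of [e] and [1 - e] would be nonzero complementary subrepresentations. *)
Lemma indecomposable_idempotent M (e : mor M M) :
  indecomposable M -> ishom e -> (forall i, e i *m e i = e i) ->
  (forall i, e i = 0) \/ (forall i, e i = 1%:M).
Proof.
move=> [_ indM] he ee.
have [/forallP e0 | /forallPn[i ei]] := boolP [forall i, e i == 0].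
  by left=> i; apply/eqP.
have [/forallP e1 | /forallPn[j ej]] := boolP [forall i, e i == 1%:M].
  by right=> j; apply/eqP.
case: indM; exists [ffun i => <<e i>>%MS], [ffun i => <<1%:M - e i>>%MS].
apply/and5P; split.
- apply/andP; split; apply/forallP => k; rewrite !ffunE ?genmx_id //.
  by rewrite genmxE (eqmxMr _ (genmxE _)) he submxMl.
- apply/andP; split; apply/forallP => k; rewrite !ffunE ?genmx_id //.
  rewrite genmxE (eqmxMr _ (genmxE _)) mulmxBl he mul1mx -{1}[rmap M k]mulmx1.
  by rewrite -mulmxBr submxMl.
- by apply/existsP; exists i; rewrite ffunE -mxrank_eq0 genmxE mxrank_eq0.
- apply/existsP; exists j; rewrite ffunE -mxrank_eq0 genmxE mxrank_eq0.
  by rewrite subr_eq0 eq_sym.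
apply/forallP=> k; rewrite !ffunE; apply/andP; split.
  rewrite sub0mx andbT submx0 -submx0; apply/rV_subP => v.
  rewrite sub_capmx !genmxE => /andP[/submxP[D ->] /submxP[D' eD]].
  by rewrite -ee mulmxA eD -mulmxA mulmxBl mul1mx ee subrr mulmx0 sub0mx.
rewrite submx1 /= -[X in (X <= _)%MS](subrK (e k)) addrC.
by rewrite addmx_sub_adds ?genmxE.
Qed.

Lemma nat_fun_collision (T : finType) (h : nat -> T) :
  exists p q, (p < q)%N /\ h p = h q.
Proof.
pose h' (k : 'I_#|T|.+1) := h k.
have /injectivePn[k [l nkl e]] : ~~ injectiveb h'.
  by apply/injectiveP=> /leq_card; rewrite card_ord ltnn.
move: nkl; rewrite neq_ltn => /orP[lt|lt]; first by exists k, l.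
by exists l, k; split.
Qed.

(** Fitting's alternative. Since the field is finite, so is the endomorphism ring; the powers of [x]
    are eventually periodic, and one of them is idempotent. *)
Lemma indecomposable_fitting M (x : mor M M) : indecomposable M -> ishom x ->
  exists2 m, (0 < m)%N &
    (forall i, x i ^+ m = 0) \/ (forall i, x i ^+ m = 1%:M).
Proof.
move=> indM hx.
have hxn k : ishom (fun i => x i ^+ k).
  elim: k => [|k IH]; first exact: ishom_id.
  move=> a; rewrite exprS -mulmxE -mulmxA IH mulmxA hx -mulmxA.
  by rewrite [in RHS]exprS.
have [p [q [lt_pq e]]] := nat_fun_collision (fun k => ffhom (fun i => x i ^+ k)).
have {}e i : x i ^+ p = x i ^+ q.
  by have := congr1 (fun f : homT M M => f i) e; rewrite !ffhomE.
pose c := (q - p)%N.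
have ec1 i j : (p <= j)%N -> x i ^+ (j + c) = x i ^+ j.
  move=> le_pj; rewrite -(subnK le_pj) -addnA subnKC ?(ltnW lt_pq) //.
  by rewrite !exprD e.
have ec i k j : (p <= j)%N -> x i ^+ (j + k * c) = x i ^+ j.
  move=> le_pj; elim: k => [|k IH]; first by rewrite addn0.
  by rewrite mulSn addnCA addnC ec1 ?(leq_trans le_pj) ?leq_addr.
(* A positive multiple of the period [c] that is at least the preperiod [p]; the successor keeps it
   positive when [p] is 0. *)
exists (p.+1 * c)%N; first by rewrite muln_gt0 subn_gt0.
apply: (indecomposable_idempotent indM (hxn _)) => i.
by rewrite mulmxE -exprD ec // (leq_trans (leqnSn p)) // leq_pmulr // subn_gt0.
Qed.

Lemma row_free_1sub_nilp n (x : 'M[F]_n) k : x ^+ k = 0 -> row_free (1%:M - x).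
Proof.
move=> xk0; rewrite -kermx_eq0; set K := kermx _.
have Kx : K *m x = K.
  by apply/esym/eqP; rewrite -subr_eq0 -{1}[K]mulmx1 -mulmxBr mulmx_ker.
have Kxk l : K *m x ^+ l = K.
  by elim: l => [|l IH]; rewrite ?mulmx1 // exprS -mulmxE mulmxA Kx.
by rewrite -(Kxk k) xk0 mulmx0.
Qed.

Lemma row_free_exp n (x : 'M[F]_n) k : row_free x -> row_free (x ^+ k).
Proof.
move=> fx; elim: k => [|k IH]; first by rewrite /row_free mxrank1.
by rewrite exprS -mulmxE /row_free mxrankMfree.
Qed.

Lemma image_factor X Y (f : mor X Y) : ishom f ->
  exists I (p : mor X I) (j : mor I Y),
    [/\ ishom p, ishom j, forall i, row_full (p i), forall i, row_free (j i)
      & forall i, p i *m j i = f i].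
Proof.
move=> hf; have sf : stable f by move=> a; rewrite hf submxMl.
have hj := sinc_hom sf; have fj := sinc_free f.
have [p pj] : exists p : mor X (srep f), forall i, p i *m sinc f i = f i.
  by exists (fun i => f i *m pinvmx (sinc f i)) => i; rewrite mulmxKpV // sinc_eq.
exists (srep f), p, (sinc f); split=> // [a|i].
  apply: (row_free_inj (fj (qtgt a))).
  by rewrite -[p _ *m _ *m _]mulmxA -[_ *m p _ *m _]mulmxA pj -hj mulmxA pj hf.
have e : \rank (p i) = \rank (f i) by rewrite -(pj i) mxrankMfree.
by rewrite /row_full e.
Qed.

(* Happel--Ringel.  With [f = p iota] the factorization through the image [I],
   the obstruction to splitting [iota], lifted along [p], is a coboundary
   [d(phi)]; hence [iota] splits up to the nilpotent endomorphism
   [iota phi p] of [I]. *)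
Lemma rigid_indecomposable_endo M (f : mor M M) :
  indecomposable M -> ext0 M M -> ishom f ->
  (forall i, f i = 0) \/ (forall i, row_free (f i)).
Proof.
move=> indM eMM hf.
have [I [p [j [hp hj fp fj pj]]]] := image_factor hf.
have [s js] : exists s : mor M I, forall i, j i *m s i = 1%:M.
  by exists (fun i => pinvmx (j i)) => i; rewrite mulmxVp.
have [t tp] : exists t : mor I M, forall i, t i *m p i = 1%:M.
  by exists (fun i => pinvmx (p i)) => i; rewrite mulVpmx.
pose d a := rmap M a *m s (qtgt a) - s (qsrc a) *m rmap I a.
have jd a : j (qsrc a) *m d a = 0.
  by rewrite mulmxBr !mulmxA hj js -[_ *m j _ *m _]mulmxA js mulmx1 mul1mx subrr.
have [phi phiE] := eMM (fun a => d a *m t (qtgt a)).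
(* Since [j] kills the defect [d], it also kills the coboundary of [phi]. *)
have hjphi : ishom (fun i => j i *m phi i).
  move=> a; apply/esym/eqP; rewrite mulmxA -hj -!mulmxA -subr_eq0 -mulmxBr -phiE.
  by rewrite mulmxA jd mul0mx.
have [r [hr rE]] : exists r : mor M I, ishom r /\ forall i, r i = s i - phi i *m p i.
  exists (fun i => s i - phi i *m p i); split=> // a.
  rewrite mulmxBl mulmxBr; apply: sub_swap.
  have := congr1 (mulmx^~ (p (qtgt a))) (phiE a).
  rewrite -[d a *m _ *m _]mulmxA tp mulmx1 -/(d a) => ->.
  by rewrite mulmxBl -!mulmxA hp.
have jr i : j i *m r i = 1%:M - j i *m phi i *m p i.
  by rewrite rE mulmxBr js mulmxA.
have [m m0 bm] := indecomposable_fitting indM (ishom_comp hp hjphi).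
(* If a power of [p j phi] is the identity, then [p] is injective, and so is [f = p j]. *)
case: bm => bm; last first.
  right=> i; have /row_freeP[p' pp'] : row_free (p i).
    apply/row_freeP; exists (j i *m phi i *m (p i *m (j i *m phi i)) ^+ m.-1).
    by rewrite -(bm i) -[in RHS](prednK m0) exprS; apply: mulmxA.
  by rewrite -pj /row_free mxrankMfree //; apply/row_freeP; exists p'.
(* Otherwise [p j phi] is nilpotent, so [j r = 1 - j phi p] is injective. If [r j] is nilpotent too,
   this forces [I = 0]; if a power of [r j] is the identity, [j] is surjective and dimensions make
   [p] injective. *)
have [n n0 cn] := indecomposable_fitting indM (ishom_comp hr hj).
have jrn i k : j i *m (r i *m j i) ^+ k = (j i *m r i) ^+ k *m j i.
  elim: k => [|k IH]; first by rewrite mulmx1 mul1mx.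
  by rewrite !exprSr -!mulmxE [LHS]mulmxA IH -!mulmxA.
have frj i : row_free (j i *m r i).
  rewrite jr; apply: (@row_free_1sub_nilp _ _ m.+1).
  have jbm k : (j i *m phi i *m p i) ^+ k.+1 =
      j i *m phi i *m (p i *m (j i *m phi i)) ^+ k *m p i.
    elim: k => [|k IH]; first by rewrite mulmx1.
    by rewrite exprSr IH exprSr -!mulmxE !mulmxA.
  by rewrite jbm bm mulmx0 mul0mx.
case: cn => cn; [left | right] => i.
  have /eqP jrn0 : (j i *m r i) ^+ n == 0.
    by rewrite -(mulmx_free_eq0 _ (fj i)) -jrn cn mulmx0.
  have := row_free_exp n (frj i); rewrite jrn0 /row_free mxrank0 => /eqP d0.
  apply/eqP; rewrite -mxrank_eq0 -pj -leqn0 [X in (_ <= X)%N]d0.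
  by rewrite (leq_trans (mxrankM_maxl _ _)) ?rank_leq_col.
have fjf : row_full (j i).
  apply/row_fullP; exists ((r i *m j i) ^+ n.-1 *m r i).
  by rewrite -(cn i) -[in RHS](prednK n0) exprSr -mulmxA.
rewrite -pj /row_free mxrankMfree //; have /eqP -> := fp i.
by have /eqP <- := fj i; rewrite (eqP fjf).
Qed.

End Bricks.

(** * The Euler form and stability *)

Lemma card_dffun_mx (F : finFieldType) (I : finType) (m n : I -> nat) :
  #|{dffun forall i, 'M[F]_(m i, n i)}| = (#|F| ^ \sum_i m i * n i)%N.
Proof.
rewrite card_dep_ffun foldrE big_map big_enum /= expn_sum.
by apply: eq_bigr => i _; rewrite card_mx.
Qed.

Section Euler.
Variables (F : finFieldType) (Q : quiver).
Local Notation rep := (rep F Q).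
Implicit Types (M X Y U : rep) (d e : 'I_(qn Q) -> nat).

(** The two sums are the exponents in [card_homT] and [card_cochT], so on dimension vectors this is
    [dim Hom - dim Ext^1]. *)
Definition euler d e : int :=
  (\sum_i d i * e i)%N%:Z - (\sum_a d (@qsrc Q a) * e (@qtgt Q a))%N%:Z.

Definition cochT X Y :=
  {dffun forall a : qarrow Q, 'M[F]_(rdim X (qsrc a), rdim Y (qtgt a))}.

Definition diff X Y (f : homT X Y) : cochT X Y :=
  [ffun a => rmap X a *m f (qtgt a) - f (qsrc a) *m rmap Y a].

Lemma card_homT X Y : #|{: homT X Y}| = (#|F| ^ \sum_i rdim X i * rdim Y i)%N.
Proof. exact: card_dffun_mx. Qed.

Lemma card_cochT X Y : #|{: cochT X Y}| =
  (#|F| ^ \sum_a rdim X (@qsrc Q a) * rdim Y (@qtgt Q a))%N.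
Proof. exact: card_dffun_mx. Qed.

Let F_gt1 : (1 < #|F|)%N := finalg.card_finNzRing_gt1 F.

(** The differential is injective; comparing cardinalities over the finite field compares
    dimensions. *)
Lemma hom0_euler X Y : hom0 X Y -> euler (rdim X) (rdim Y) <= 0.
Proof.
move=> XY0; rewrite subr_le0 lez_nat -(leq_exp2l _ _ F_gt1) -card_homT -card_cochT.
apply: (leq_card (@diff X Y)) => f g /ffunP fg; apply/ffunP => i.
apply/eqP; rewrite -subr_eq0; apply/eqP; apply: (XY0 (fun i => f i - g i)) => a.
have := fg a; rewrite !ffunE mulmxBl mulmxBr.
exact: sub_swap.
Qed.

(** Here the differential is onto but not injective, as [f] and 0 have the same image. *)
Lemma ext0_euler X Y (f : mor X Y) i : ext0 X Y -> ishom f -> f i != 0 ->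
  0 < euler (rdim X) (rdim Y).
Proof.
move=> eXY hf fi0; rewrite subr_gt0 ltz_nat -(ltn_exp2l _ _ F_gt1) -card_homT -card_cochT.
have <- : #|@diff X Y @: setT| = #|{: cochT X Y}|.
  rewrite -cardsT; apply: eq_card => c; rewrite !inE; apply/imsetP.
  have [g gE] := eXY (fun a => c a); exists (ffhom g) => //.
  by apply/ffunP => a; rewrite ffunE gE !ffhomE.
rewrite -cardsT ltn_neqAle leq_imset_card andbT.
apply: contraNneq fi0 => /eqP/imset_injP dinj.
have /dinj : diff (ffhom f) = diff (ffhom (fun i => 0 : 'M_(rdim X i, rdim Y i))).
  by apply/ffunP => a; rewrite !ffunE hf mulmx0 mul0mx !subrr.
by move=> /(_ (in_setT _) (in_setT _))/(congr1 (fun h : homT X Y => h i)); rewrite !ffhomE => ->.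
Qed.

Definition weight (w : 'I_(qn Q) -> int) d : int := \sum_i w i * (d i)%:Z.

Lemma weightD w d e : weight w (fun i => d i + e i)%N = weight w d + weight w e.
Proof. by rewrite -big_split /=; apply: eq_bigr => i _; rewrite PoszD mulrDr. Qed.

Lemma eq_weight w d e : d =1 e -> weight w d = weight w e.
Proof. by move=> de; apply: eq_bigr => i _; rewrite de. Qed.

(* The coefficients of [d |-> <m, d> - <d, m>], for which an exceptional
   representation of dimension vector [m] is stable. *)
Definition euler_weight (m : 'I_(qn Q) -> nat) i : int :=
  (\sum_(a | @qsrc Q a == i) m (@qtgt Q a))%N%:Z -
  (\sum_(a | @qtgt Q a == i) m (@qsrc Q a))%N%:Z.

Lemma weight_euler m d : weight (euler_weight m) d = euler m d - euler d m.
Proof.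
rewrite /weight /euler.
have -> : (\sum_i m i * d i = \sum_i d i * m i)%N.
  by apply: eq_bigr => i _; rewrite mulnC.
rewrite opprB [RHS]addrC addrA subrK.
rewrite (eq_bigr _ (fun i _ => mulrBl _ _ _)) sumrB; congr (_ - _).
  rewrite (partition_big (@qsrc Q) predT) //= -natz natr_sum; apply: eq_bigr => i _.
  rewrite -PoszM natz big_distrl; congr Posz; apply: eq_bigr => a /eqP<-.
  by rewrite mulnC.
rewrite (partition_big (@qtgt Q) predT) //= -natz natr_sum; apply: eq_bigr => i _.
by rewrite -PoszM natz big_distrl; congr Posz; apply: eq_bigr => a /eqP<-.
Qed.

(** For a proper nonzero [U] in [M], [<dim U, dim M>] is positive, because [Ext^1(U, M) = 0] by
    heredity while [j] is nonzero. And [<dim M, dim U>] is at most 0, because [Hom(M, U) = 0]. *)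
Lemma exceptional_stable M U (j : mor U M) i k :
  indecomposable M -> ext0 M M -> ishom j -> (forall i, row_free (j i)) ->
  (0 < rdim U i)%N -> ~~ row_full (j k) ->
  weight (euler_weight (rdim M)) (rdim U) < 0.
Proof.
move=> indM eMM hj fj Ui jk; rewrite weight_euler subr_lt0.
apply: (@le_lt_trans _ _ 0); last first.
  apply: (@ext0_euler U M j i) => //; first exact: ext0_sub hj fj eMM.
  by rewrite -mxrank_eq0 (eqP (fj i)) -lt0n.
apply: hom0_euler => h hh.
(* A map [h] from [M] to [U] yields the endomorphism [h j], zero or injective; injectivity would
   make [j] surjective. *)
have [hj0 l | hjf] := rigid_indecomposable_endo indM eMM (ishom_comp hh hj).
  by apply/eqP; rewrite -(mulmx_free_eq0 _ (fj l)) hj0.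
case/negP: jk; rewrite -col_leq_rank -{1}(eqP (hjf k)).
by rewrite mxrankM_maxr.
Qed.

(** A nonzero [f] from [X] to [M] exists by positivity of the Euler form. Its kernel has weight at
    most 0 and [dim M] has weight 0, so its image has weight at least 0; by stability of [M] the
    image is all of [M]. *)
Lemma semistable_exceptional M X :
  indecomposable M -> ext0 M M -> (forall i, rdim X i = rdim M i) ->
  (forall U (j : mor U X), ishom j -> (forall i, row_free (j i)) ->
     weight (euler_weight (rdim M)) (rdim U) <= 0) ->
  iso X M.
Proof.
move=> indM eMM dX ssX; set w := euler_weight _ in ssX.
have euXM : 0 < euler (rdim X) (rdim M).
  have -> : euler (rdim X) (rdim M) = euler (rdim M) (rdim M).
    by congr (_%:Z - _%:Z); apply: eq_bigr => i _; rewrite dX.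
  have [[i Mi] _] := indM; apply: (@ext0_euler M M (fun i => 1%:M) i) => //.
    exact: ishom_id.
  by rewrite -mxrank_eq0 mxrank1 -lt0n.
have [f hf [i fi]] : exists2 f : mor X M, ishom f & exists i, f i != 0.
  apply: NNPP => nf; move: euXM; rewrite ltNge => /negP; apply; apply: hom0_euler.
  move=> f hf i; apply/eqP; apply: contraT => fi.
  by case: nf; exists f => //; exists i.
have [I [p [j [hp hj fp fj pj]]]] := image_factor hf.
pose K i := kermx (f i).
have sK : stable K.
  by move=> a; apply/sub_kermxP; rewrite -mulmxA -hf mulmxA mulmx_ker mul0mx.
have wK := ssX _ _ (sinc_hom sK) (sinc_free K).
have dI l : rdim I l = \rank (f l) by rewrite -pj mxrankMfree // (eqP (fp l)).
have wKI : weight w (rdim (srep K)) + weight w (rdim I) = 0.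
  rewrite -weightD; have -> : 0 = weight w (rdim M) by rewrite weight_euler subrr.
  apply: eq_weight => l /=.
  by rewrite dI mxrank_ker subnK ?rank_leq_row.
have jf l : row_full (j l).
  apply: contraT => njl.
  have Ii : (0 < rdim I i)%N by rewrite dI lt0n mxrank_eq0.
  have := exceptional_stable indM eMM hj fj Ii njl.
  rewrite -/w => wI; have := ltr_leD wI wK.
  by rewrite addrC wKI addr0 ltxx.
apply/existsP; exists (ffhom f); rewrite is_hom_ff //=; apply/forallP=> l.
rewrite ffhomE /row_free /row_full -dI dX andbb.
by rewrite -(eqP (jf l)) (eqP (fj l)).
Qed.

End Euler.

(** * The Hall product *)

Section HallProduct.
Variables (F : finFieldType) (Q : quiver).
Local Notation rep := (rep F Q).
Implicit Types (M N X Y Z : rep) (d e : 'I_(qn Q) -> nat).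
Local Notation hall := (hall F Q).

(** The type [hall] admits arbitrary functions on representations; these are the ones that only
    depend on isomorphism classes. *)
Definition iso_inv (f : hall) := forall X Y, iso X Y -> f X = f Y.

Lemma cls_inv M : iso_inv (cls M).
Proof.
move=> X Y XY; congr (nat_of_bool _)%:R; apply/idP/idP; last exact: iso_trans.
by apply: iso_trans; rewrite iso_sym.
Qed.

Section OneSubrep.
Variables (X : rep) (U : subfam X).

Definition sub_of : rep := srep (fun i => U i).
Definition quo_of : rep := qrep (fun i => U i).

Lemma is_subrep_stable : is_subrep U -> stable (fun i => U i).
Proof. by case/andP=> _ /forallP. Qed.

Lemma is_subrep_genmx i : is_subrep U -> <<U i>>%MS = U i.
Proof. by case/andP=> /forallP/(_ i)/eqP. Qed.

Lemma sub_isoP N : reflect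
  (exists2 f : mor N X, ishom f &
     forall i, row_free (f i) /\ (f i :=: U i)%MS) (sub_iso U N).
Proof.
apply: (iffP existsP) => [[f /andP[/is_homP hf /forallP ff]] | [f hf ff]].
  by exists (fun i => f i) => // i; case/andP: (ff i) => ? /eqmxP.
exists (ffhom f); rewrite is_hom_ff //=; apply/forallP=> i; rewrite ffhomE.
by have [-> fU] := ff i; apply/eqmxP.
Qed.

Lemma quot_isoP M : reflect
  (exists2 f : mor X M, ishom f &
     forall i, row_full (f i) /\ (kermx (f i) :=: U i)%MS) (quot_iso U M).
Proof.
apply: (iffP existsP) => [[f /andP[/is_homP hf /forallP ff]] | [f hf ff]].
  by exists (fun i => f i) => // i; case/andP: (ff i) => ? /eqmxP.
exists (ffhom f); rewrite is_hom_ff //=; apply/forallP=> i; rewrite ffhomE.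
by have [-> fU] := ff i; apply/eqmxP.
Qed.

Lemma sub_iso_sub_of : is_subrep U -> sub_iso U sub_of.
Proof.
move=> sU; apply/sub_isoP; exists (sinc (fun i => U i)).
  exact/sinc_hom/is_subrep_stable.
by move=> i; split; [exact: sinc_free | exact: sinc_eq].
Qed.

Lemma quot_iso_quo_of : is_subrep U -> quot_iso U quo_of.
Proof.
move=> sU; apply/quot_isoP; exists (qproj (fun i => U i)).
  exact/qproj_hom/is_subrep_stable.
by move=> i; split; [exact: qbase_full | exact: qbase_ker].
Qed.

Lemma sub_iso_iso N N' : sub_iso U N -> sub_iso U N' = iso N' N.
Proof.
move=> /sub_isoP[f hf ff]; apply/idP/idP => [/sub_isoP[g hg gg] | /isoP[h [k [hh hk hkK khK]]]].
  have [h hE] : exists h : mor N' N, forall i, h i *m f i = g i.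
    exists (fun i => g i *m pinvmx (f i)) => i; rewrite mulmxKpV //.
    by have [_ ->] := ff i; have [_ ->] := gg i.
  have [k kE] : exists k : mor N N', forall i, k i *m g i = f i.
    exists (fun i => f i *m pinvmx (g i)) => i; rewrite mulmxKpV //.
    by have [_ ->] := gg i; have [_ ->] := ff i.
  apply/isoP; exists h, k; split.
  - move=> a; have [fa _] := ff (qtgt a); apply: (row_free_inj fa).
    by rewrite -[h _ *m _ *m _]mulmxA -[_ *m h _ *m _]mulmxA hE -hf mulmxA hE hg.
  - move=> a; have [fa _] := gg (qtgt a); apply: (row_free_inj fa).
    by rewrite -[k _ *m _ *m _]mulmxA -[_ *m k _ *m _]mulmxA kE -hg mulmxA kE hf.
  - move=> i; have [fa _] := gg i; apply: (row_free_inj fa).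
    by rewrite -mulmxA kE hE mul1mx.
  - move=> i; have [fa _] := ff i; apply: (row_free_inj fa).
    by rewrite -mulmxA hE kE mul1mx.
apply/sub_isoP; exists (fun i => h i *m f i); first exact: ishom_comp.
move=> i; have [fi fU] := ff i; split.
  by rewrite /row_free mxrankMfree //; apply/row_freeP; exists (k i).
by apply: eqmx_trans fU; apply: eqmxMfull; apply/row_fullP; exists (k i).
Qed.

Lemma quot_iso_iso M M' : quot_iso U M -> quot_iso U M' = iso M' M.
Proof.
move=> /quot_isoP[f hf ff]; apply/idP/idP => [/quot_isoP[g hg gg] | /isoP[h [k [hh hk hkK khK]]]].
  have kerE i : (kermx (f i) :=: kermx (g i))%MS.
    have [_ e] := ff i; have [_ e'] := gg i.
    by apply: (eqmx_trans e); apply: eqmx_sym.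
  have [h hE] : exists h : mor M' M, forall i, g i *m h i = f i.
    exists (fun i => pinvmx (g i) *m f i) => i; apply: mulmx_pinv_ker.
    by apply/sub_kermxP; rewrite kerE.
  have [k kE] : exists k : mor M M', forall i, f i *m k i = g i.
    exists (fun i => pinvmx (f i) *m g i) => i; apply: mulmx_pinv_ker.
    by apply/sub_kermxP; rewrite kerE.
  apply/isoP; exists h, k; split.
  - move=> a; have [fa _] := gg (qsrc a); apply: (row_full_inj fa).
    by rewrite !mulmxA hE hg -mulmxA hE hf.
  - move=> a; have [fa _] := ff (qsrc a); apply: (row_full_inj fa).
    by rewrite !mulmxA kE hf -mulmxA kE hg.
  - move=> i; have [fa _] := gg i; apply: (row_full_inj fa).
    by rewrite mulmxA hE kE mulmx1.
  - move=> i; have [fa _] := ff i; apply: (row_full_inj fa).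
    by rewrite mulmxA kE hE mulmx1.
apply/quot_isoP; exists (fun i => f i *m k i); first exact: ishom_comp.
have kf i : row_free (k i) by apply/row_freeP; exists (h i).
move=> i; have [fi fU] := ff i; split.
  by rewrite /row_full mxrankMfree // (eqP fi); apply/eqP/iso_dim/isoP; exists k, h.
apply: eqmx_trans fU; apply/eqmxP/andP; split; apply/sub_kermxP.
  by apply/eqP; rewrite -(mulmx_free_eq0 _ (kf i)) -mulmxA mulmx_ker.
by rewrite mulmxA mulmx_ker mul0mx.
Qed.

End OneSubrep.

Lemma emb_rmap_iso X : iso (@emb F Q (rdim X) [ffun a => rmap X a]) X.
Proof.
apply/isoP; do 2!exists (fun i => 1%:M : 'M[F]_(rdim X i)).
by split; try (by move=> a; rewrite /= ffunE mul1mx mulmx1); move=> i; rewrite mulmx1.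
Qed.

(** The factor [orb m] counts the matrix families isomorphic to [Z], each of which contributes the
    same value. *)
Lemma sum_iso_class (f : hall) Z : iso_inv f ->
  \sum_(m : repd F (rdim Z)) f (emb m) * ((iso (emb m) Z)%:R / (orb m)%:R) = f Z.
Proof.
move=> finv; pose m0 : repd F (rdim Z) := [ffun a => rmap Z a].
have m0Z : iso (emb m0) Z := emb_rmap_iso Z.
rewrite (bigID (fun m : repd F (rdim Z) => iso (emb m) Z)) /=.
rewrite [X in _ + X]big1 ?addr0; last by move=> m /negPf->; rewrite mul0r mulr0.
have orbE (m : repd F (rdim Z)) : iso (emb m) Z ->
    orb m = #|[set m' : repd F (rdim Z) | iso (emb m') Z]|.
  move=> mZ; apply: eq_card => m'; rewrite !inE.
  apply/idP/idP => m'm; first exact: iso_trans m'm mZ.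
  by apply: iso_trans m'm _; rewrite iso_sym.
rewrite (eq_bigr (fun=> f Z / #|[set m' : repd F (rdim Z) | iso (emb m') Z]|%:R)); last first.
  by move=> m mZ; rewrite mZ (finv _ _ mZ) orbE // mul1r.
rewrite big_const iter_addr_0 -[LHS]mulr_natr.
rewrite [X in _ * X%:R](_ : _ = #|[set m' : repd F (rdim Z) | iso (emb m') Z]|); last first.
  by apply: eq_card => m; rewrite !inE.
rewrite mulfVK // pnatr_eq0 -lt0n.
by apply/card_gt0P; exists m0; rewrite inE.
Qed.

(** The form of the product used from here on: the normalized sums over representatives collapse to
    the actual quotient and subrepresentation. *)
Lemma hmulE (f g : hall) X : iso_inv f -> iso_inv g ->
  hmul f g X = \sum_(U : subfam X | is_subrep U) f (quo_of U) * g (sub_of U).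
Proof.
move=> finv ginv; apply: eq_bigr => U sU.
rewrite -(sum_iso_class (quo_of U) finv) -(sum_iso_class (sub_of U) ginv).
rewrite big_distrl /=; apply: eq_bigr => m _.
rewrite big_distrr /=; apply: eq_bigr => m' _.
rewrite (quot_iso_iso _ (quot_iso_quo_of sU)) (sub_iso_iso _ (sub_iso_sub_of sU)).
by rewrite [RHS]mulrACA -mulnb natrM invfM; congr (_ * _); rewrite mulrACA.
Qed.

Lemma eq_hmul (f f' g g' : hall) : f =1 f' -> g =1 g' -> hmul f g =1 hmul f' g'.
Proof.
move=> ff' gg' X; apply: eq_bigr => U _; apply: eq_bigr => m _.
by apply: eq_bigr => m' _; rewrite ff' gg'.
Qed.

(** An isomorphism carries subrepresentations to subrepresentations, with isomorphic subs and
    quotients. Canonical [genmx] representatives make the transports [h] and [h'] strictly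
    inverse. *)
Lemma hmul_inv (f g : hall) : iso_inv f -> iso_inv g -> iso_inv (hmul f g).
Proof.
move=> finv ginv X Y XY; rewrite !hmulE //.
have /isoP[p [q [hp hq pq qp]]] := XY.
pose h (U : subfam X) : subfam Y := [ffun i => <<U i *m p i>>%MS].
pose h' (V : subfam Y) : subfam X := [ffun i => <<V i *m q i>>%MS].
have hK U : is_subrep U -> h' (h U) = U.
  move=> sU; apply/ffunP => i; rewrite !ffunE -[RHS]is_subrep_genmx //.
  by apply/eq_genmx/(eqmx_trans (eqmxMr _ (genmxE _))); rewrite -mulmxA pq mulmx1.
have h'K V : is_subrep V -> h (h' V) = V.
  move=> sV; apply/ffunP => i; rewrite !ffunE -[RHS]is_subrep_genmx //.
  by apply/eq_genmx/(eqmx_trans (eqmxMr _ (genmxE _))); rewrite -mulmxA qp mulmx1.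
have hs U : is_subrep U -> is_subrep (h U).
  move=> sU; apply/andP; split; apply/forallP => a; rewrite !ffunE ?genmx_id //.
  rewrite genmxE (eqmxMr _ (genmxE _)) -mulmxA hp mulmxA submxMr //.
  exact: is_subrep_stable.
have h's V : is_subrep V -> is_subrep (h' V).
  move=> sV; apply/andP; split; apply/forallP => a; rewrite !ffunE ?genmx_id //.
  rewrite genmxE (eqmxMr _ (genmxE _)) -mulmxA hq mulmxA submxMr //.
  exact: is_subrep_stable.
rewrite [RHS](reindex_onto h h') => [|V sV]; last exact: h'K.
apply: eq_big => [U | U sU].
  apply/idP/andP => [sU | [shU /eqP<-]]; last exact: h's.
  by rewrite hs // hK.
have pf i : row_free (p i) by apply/row_freeP; exists (q i).
congr (_ * _); [apply: finv | apply: ginv]; rewrite iso_sym.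
  rewrite -(quot_iso_iso _ (quot_iso_quo_of sU)).
  have /quot_isoP[k hk kk] := quot_iso_quo_of (hs U sU).
  apply/quot_isoP; exists (fun i => p i *m k i); first exact: ishom_comp.
  move=> i; have [ki kU] := kk i; split.
    by rewrite /row_full eqmxMfull //; apply/row_fullP; exists (q i).
  apply/eqmxP/andP; split.
    have : (kermx (p i *m k i) *m p i <= kermx (k i))%MS.
      by apply/sub_kermxP; rewrite -mulmxA mulmx_ker.
    rewrite kU ffunE genmxE => /submxP[D /(congr1 (mulmx^~ (q i)))].
    rewrite -(mulmxA (kermx _)) pq mulmx1 -(mulmxA D) -(mulmxA (U i)) pq mulmx1.
    by move=> ->; apply: submxMl.
  apply/sub_kermxP; rewrite mulmxA; apply/sub_kermxP.
  by rewrite kU ffunE genmxE.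
rewrite -(sub_iso_iso _ (sub_iso_sub_of sU)).
have /sub_isoP[k hk kk] := sub_iso_sub_of (hs U sU).
apply/sub_isoP; exists (fun i => k i *m q i); first exact: ishom_comp.
move=> i; have [ki kU] := kk i; split.
  by rewrite /row_free mxrankMfree //; apply/row_freeP; exists (p i).
apply: (eqmx_trans (eqmxMr _ kU)); rewrite ffunE.
by apply: (eqmx_trans (eqmxMr _ (genmxE _))); rewrite -mulmxA pq mulmx1.
Qed.

End HallProduct.

(** * The composition algebra *)

Lemma thin_mx_eq (F : fieldType) m n (x y : 'M[F]_(m, n)) :
  (m == 0) || (n == 0) -> x = y.
Proof.
case/orP=> /eqP e; apply/matrixP => i j.
  by have := ltn_ord i; rewrite [X in (_ < X)%N]e.
by have := ltn_ord j; rewrite [X in (_ < X)%N]e.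
Qed.

Section Composition.
Variables (F : finFieldType) (Q : quiver).
Local Notation rep := (rep F Q).
Implicit Types (A B M N X Y Z : rep) (d e : 'I_(qn Q) -> nat).
Local Notation hall := (hall F Q).
Local Notation comp := (@composition_alg F Q).

Lemma comp_sum (I : Type) (r : seq I) (P : pred I) (f : I -> hall) :
  (forall i, P i -> comp (f i)) -> comp (fun X => \sum_(i <- r | P i) f i X).
Proof.
move=> cf; elim: r => [|i r IH].
  by apply: (gen_ext (gen_scale 0 (gen_one _))) => X; rewrite big_nil mul0r.
have [Pi | nPi] := boolP (P i); last first.
  by apply: (gen_ext IH) => X; rewrite big_cons (negPf nPi).
by apply: (gen_ext (gen_add (cf i Pi) IH)) => X; rewrite big_cons Pi.
Qed.

Lemma comp_sub (f g : hall) : comp f -> comp g -> comp (fun X => f X - g X).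
Proof.
move=> cf cg; apply: (gen_ext (gen_add cf (gen_scale (-1) cg))) => X.
by rewrite mulN1r.
Qed.

Lemma comp_iso X Y : iso X Y -> comp (cls X) -> comp (cls Y).
Proof.
move=> XY cX; apply: (gen_ext cX) => Z; congr (nat_of_bool _)%:R.
apply/idP/idP => [ZX | ZY]; first exact: iso_trans XY.
by apply: iso_trans ZY _; rewrite iso_sym.
Qed.

(* If [Ext^1(A, B) = 0], then [[A][B]] is a nonzero multiple of [[A + B]]. *)
Lemma comp_biprod X A B :
  biprod X A B -> ext0 A B -> comp (cls A) -> comp (cls B) -> comp (cls X).
Proof.
move=> XAB eAB cA cB; pose h := hmul (cls A) (cls B).
have hinv : iso_inv h := hmul_inv (cls_inv A) (cls_inv B).
(* All terms are nonnegative, and the copy of [B] inside the biproduct contributes 1. *)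
have hX : h X != 0.
  rewrite /h hmulE; try exact: cls_inv.
  have [sA [rA [sB [rB [[hsA hrA hsB hrB] k]]]]] := XAB.
  pose U : subfam X := [ffun i => <<sB i>>%MS].
  have sU : is_subrep U.
    apply/andP; split; apply/forallP => a; rewrite !ffunE ?genmx_id //.
    by rewrite genmxE (eqmxMr _ (genmxE _)) hsB submxMl.
  have qU : quot_iso U A.
    apply/quot_isoP; exists rA => // i; have [AA _ _ BA e] := k i; split.
      by apply/row_fullP; exists (sA i).
    rewrite ffunE; apply: (eqmx_trans _ (eqmx_sym (genmxE _))).
    apply/eqmxP/andP; split; last exact/sub_kermxP.
    by rewrite -[kermx _]mulmx1 -e mulmxDr mulmxA mulmx_ker mul0mx add0r mulmxA submxMl.
  have bU : sub_iso U B.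
    apply/sub_isoP; exists sB => // i; have [_ BB _ _ _] := k i; split.
      by apply/row_freeP; exists (rB i).
    by rewrite ffunE; apply/eqmx_sym/genmxE.
  rewrite (bigD1 U) //= /cls; apply: lt0r_neq0; apply: ltr_pwDl.
    rewrite iso_sym -(quot_iso_iso _ (quot_iso_quo_of sU)) qU.
    by rewrite iso_sym -(sub_iso_iso _ (sub_iso_sub_of sU)) bU.
  by apply: sumr_ge0 => V _; rewrite mulr_ge0 ?ler0n.
apply: (gen_ext (gen_scale (h X)^-1 (gen_mul cA cB))) => Z; rewrite -/(h Z) {1}/cls.
have [ZX | nZX] := boolP (iso Z X); first by rewrite (hinv _ _ ZX) mulVf.
(* A nonzero term would present [Z] as an extension of [A] by [B], which splits and makes [Z]
   isomorphic to [X]. *)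
suff -> : h Z = 0 by rewrite mulr0.
rewrite /h hmulE; try exact: cls_inv.
apply: big1 => U sU; rewrite /cls -natrM mulnb.
case: andP => // -[qA qB]; case/negP: nZX.
have /quot_isoP[p hp pp] : quot_iso U A.
  by rewrite (quot_iso_iso _ (quot_iso_quo_of sU)) iso_sym.
have /sub_isoP[j hj jj] : sub_iso U B.
  by rewrite (sub_iso_iso _ (sub_iso_sub_of sU)) iso_sym.
apply: biprod_iso XAB; apply: (ext0_biprod hj hp) => // i.
- by case: (jj i).
- by case: (pp i).
by have [_ e] := pp i; have [_ e'] := jj i; apply: (eqmx_trans e (eqmx_sym e')).
Qed.

Definition has_dim d X := [forall i, rdim X i == d i].

Lemma has_dimP d X : reflect (rdim X =1 d) (has_dim d X).
Proof. exact: 'forall_eqP. Qed.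

Lemma has_dim_iso d X Y : iso X Y -> has_dim d X = has_dim d Y.
Proof. by move=> XY; apply: eq_forallb => i; rewrite (iso_dim i XY). Qed.

Lemma iso_zero X : iso X (zero_rep F Q) = has_dim (fun=> 0%N) X.
Proof.
apply/idP/has_dimP => [XZ i | X0]; first by rewrite (iso_dim i XZ).
apply/isoP; exists (fun=> 0), (fun=> 0); split=> [a|a|i|i]; apply: thin_mx_eq;
  by rewrite ?X0 ?eqxx ?orbT.
Qed.

Lemma hmul1 (f : hall) : iso_inv f -> hmul f (@hone F Q) =1 f.
Proof.
move=> finv X; rewrite hmulE //; last exact: cls_inv.
pose U0 : subfam X := [ffun i => 0].
have s0 : is_subrep U0.
  apply/andP; split; apply/forallP => a; rewrite !ffunE ?genmx0 //.
  by rewrite mul0mx sub0mx.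
rewrite (bigD1 U0) //= [X in _ + X]big1 ?addr0.
  rewrite /hone /cls iso_zero (introT (has_dimP _ _)) ?mulr1 => [|i] /=; last first.
    by rewrite ffunE mxrank0.
  apply: finv; rewrite iso_sym -(quot_iso_iso _ (quot_iso_quo_of s0)).
  apply/quot_isoP; exists (fun i => 1%:M); first exact: ishom_id.
  move=> i; rewrite ffunE row_full_unit unitmx1; split=> //.
  by apply/eqmxP; rewrite sub0mx andbT submx0 kermx_eq0 row_free_unit unitmx1.
move=> U /andP[sU nU0]; rewrite /hone /cls iso_zero.
case: has_dimP => [dU|]; last by rewrite mulr0.
case/eqP: nU0; apply/ffunP => i; rewrite ffunE; apply/eqP; rewrite -mxrank_eq0.
exact/eqP/(dU i).
Qed.

Lemma mul1h (f : hall) : iso_inv f -> hmul (@hone F Q) f =1 f.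
Proof.
move=> finv X; rewrite hmulE //; last exact: cls_inv.
pose U1 : subfam X := [ffun i => <<1%:M>>%MS].
have s1 : is_subrep U1.
  apply/andP; split; apply/forallP => a; rewrite !ffunE ?genmx_id //.
  by rewrite genmxE submx1.
rewrite (bigD1 U1) //= [X in _ + X]big1 ?addr0.
  rewrite /hone /cls iso_zero (introT (has_dimP _ _)) ?mul1r => [|i] /=; last first.
    by rewrite ffunE genmxE mxrank1 subnn.
  apply: finv; rewrite iso_sym -(sub_iso_iso _ (sub_iso_sub_of s1)).
  apply/sub_isoP; exists (fun i => 1%:M); first exact: ishom_id.
  move=> i; rewrite ffunE row_free_unit unitmx1; split=> //.
  exact/eqmx_sym/genmxE.
move=> U /andP[sU nU1]; rewrite /hone /cls iso_zero.
case: has_dimP => [dU|]; last by rewrite mul0r.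
case/eqP: nU1; apply/ffunP => i; rewrite ffunE -[LHS]is_subrep_genmx //.
apply/eq_genmx/eqmxP; rewrite submx1 sub1mx -col_leq_rank -subn_eq0.
exact/eqP/(dU i).
Qed.

Lemma sub_of_dim X (U : subfam X) i : rdim (sub_of U) i = \rank (U i).
Proof. by []. Qed.

Lemma quo_of_dim X (U : subfam X) i : (rdim (quo_of U) i + \rank (U i))%N = rdim X i.
Proof. by rewrite subnK // rank_leq_col. Qed.

Definition ind_dim d : hall := fun X => (has_dim d X)%:R.

Lemma ind_dim_inv d : iso_inv (ind_dim d).
Proof.
by move=> X Y XY; rewrite /ind_dim (has_dim_iso d XY).
Qed.

Lemma ind_dim0 d : (forall i, d i = 0%N) -> ind_dim d =1 @hone F Q.
Proof.
move=> d0 X; rewrite /hone /cls iso_zero; congr (nat_of_bool _)%:R.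
by apply: eq_forallb => i; rewrite d0.
Qed.

(** * Sums of all classes of a given dimension vector *)

Hypothesis acQ : acyclic Q.

Definition vertex_dim (i : 'I_(qn Q)) k := fun j => ((j == i) * k)%N.

Lemma no_loop a : @qsrc Q a != qtgt a.
Proof. by apply: contraTneq (acQ a) => <-; rewrite negbK connect0. Qed.

(** Without loops no arrow has both ends at [i], so the arrow maps of a representation supported at
    [i] are empty matrices. *)
Lemma vertex_thin i k l (a : qarrow Q) :
  (vertex_dim i k (qsrc a) == 0%N) || (vertex_dim i l (qtgt a) == 0%N).
Proof.
rewrite /vertex_dim; have [e | _] := eqVneq (qsrc a) i; last by rewrite mul0n.
by rewrite -e [qtgt a == _]eq_sym (negPf (no_loop a)) mul0n eqxx orbT.
Qed.

Lemma vertex_iso i k X Y :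
  has_dim (vertex_dim i k) X -> has_dim (vertex_dim i k) Y -> iso X Y.
Proof.
move=> /has_dimP dX /has_dimP dY.
apply/existsP; exists (ffhom (fun j => pid_mx (rdim X j) : 'M_(rdim X j, rdim Y j))).
rewrite is_hom_ff /=; last first.
  by move=> a; apply: thin_mx_eq; rewrite dX dY vertex_thin.
apply/forallP => j; rewrite ffhomE /row_free /row_full.
by rewrite rank_pid_mx // dX dY ?leqnn ?eqxx.
Qed.

(** Multiples of a simple are reached one summand at a time: the extension by the zero cochain is
    the direct sum, and [Ext^1] vanishes for lack of loops. *)
Lemma comp_vertex i k X : has_dim (vertex_dim i k) X -> comp (cls X).
Proof.
elim: k X => [|k IH] X dX.
  apply: comp_iso (gen_one _); rewrite iso_sym iso_zero; apply/has_dimP => j.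
  by rewrite (has_dimP _ _ dX) /vertex_dim muln0.
pose Y : rep := @Rep F Q (vertex_dim i k) (fun a => 0).
have dY : has_dim (vertex_dim i k) Y by apply/has_dimP.
pose c a : 'M[F]_(rdim (simple_rep F i) (qsrc a), rdim Y (qtgt a)) := 0.
have cS : comp (cls (simple_rep F i)) by apply: gen_gen; exists i.
have eSY : ext0 (simple_rep F i) Y.
  move=> c'; exists (fun=> 0) => a; apply: thin_mx_eq.
  by have := vertex_thin i 1 k a; rewrite {1}/vertex_dim muln1.
have EY : biprod (extrep c) (simple_rep F i) Y.
  apply: (ext0_biprod (ext_inj_hom c) (ext_proj_hom c)) eSY.
  - exact: ext_inj_free.
  - exact: ext_proj_full.
  - exact: ext_exact.
apply: comp_iso (comp_biprod EY eSY cS (IH Y dY)).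
apply: (@vertex_iso i k.+1) => //; apply/has_dimP => j /=.
by rewrite /vertex_dim mulnS addnC.
Qed.

(** A vertex of the support that reaches the fewest vertices: an arrow to another supported vertex
    would reach strictly fewer, by acyclicity. *)
Lemma exists_sink d : (exists i, 0 < d i)%N ->
  exists2 i, (0 < d i)%N & forall a, @qsrc Q a = i -> d (qtgt a) = 0%N.
Proof.
case=> i0 di0.
case: (@arg_minnP _ i0 (fun i => 0 < d i)%N (fun i => #|connect (@qedge Q) i|) di0).
move=> i di imin; exists i => // a ai.
apply/eqP; rewrite -leqn0 leqNgt; apply/negP => /imin; rewrite leqNgt => /negP; apply.
have ia : qedge i (qtgt a) by apply/existsP; exists a; rewrite ai !eqxx.
apply/proper_card/properP; split.
  by apply/subsetP => j; apply: connect_trans; apply: connect1.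
exists i; first exact: connect0.
by have := acQ a; rewrite ai.
Qed.

(** A sink [i] of the support is split off: each [X] of dimension [d] has exactly one
    subrepresentation of dimension [d i] concentrated at [i], so [ind_dim d] is a product of two
    indicators. *)
Lemma comp_ind_dim d : comp (ind_dim d).
Proof.
have [n le_dn] := ubnP (\sum_i d i)%N; elim: n d le_dn => // n IH d le_dn.
have [/existsP di | /existsPn d0] := boolP [exists i, 0 < d i]%N; last first.
  apply: (gen_ext (gen_one _)) => X; rewrite ind_dim0 // => i.
  by apply/eqP; rewrite -leqn0 leqNgt.
have {di} [i di snk] := exists_sink di.
pose d' j := ((j != i) * d j)%N.
have dd' j : d j = (d' j + vertex_dim i (d i) j)%N.
  by rewrite /d' /vertex_dim; have [->|_] := eqVneq j i; rewrite ?mul1n ?addn0.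
have cd' : comp (ind_dim d').
  apply: IH; rewrite -ltnS; apply: leq_trans le_dn; rewrite ltnS.
  rewrite [X in (_ < X)%N](eq_bigr _ (fun j _ => dd' j)) big_split /=.
  rewrite -addn1 leq_add2l (bigD1 i) //= {1}/vertex_dim eqxx mul1n.
  by rewrite (leq_trans di) // leq_addr.
have cv : comp (ind_dim (vertex_dim i (d i))).
  pose Y : rep := @Rep F Q (vertex_dim i (d i)) (fun a => 0).
  have dY : has_dim (vertex_dim i (d i)) Y by apply/has_dimP.
  apply: (gen_ext (comp_vertex dY)) => X; congr (nat_of_bool _)%:R.
  apply/idP/idP => [XY | dX]; last exact: vertex_iso dX dY.
  by apply/has_dimP => j; rewrite (iso_dim j XY).
apply: (gen_ext (gen_mul cd' cv)) => X.
rewrite hmulE; try exact: ind_dim_inv.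
pose U : subfam X := [ffun j => <<((j == i)%B%:R%:M)%R>>%MS].
rewrite /ind_dim; case: (has_dimP d X) => [dX | ndX]; last first.
  apply: big1 => V _; rewrite -natrM mulnb; case: andP => // -[/has_dimP q /has_dimP s].
  by case: ndX => j; rewrite -(quo_of_dim V) q -sub_of_dim s -dd'.
have rU j : \rank (U j) = vertex_dim i (d i) j.
  rewrite ffunE genmxE /vertex_dim; have [->|_] := eqVneq j i.
    by rewrite mxrank1 dX mul1n.
  by rewrite raddf0 mxrank0.
(* Arrows leaving [i] end where [d] vanishes, so the full space at [i] is stable. *)
have sU : is_subrep U.
  apply/andP; split; apply/forallP => a; rewrite !ffunE ?genmx_id //.
  rewrite genmxE (eqmxMr _ (genmxE _)); have [e|_] := eqVneq (qsrc a) i; last first.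
    by rewrite raddf0 mul0mx sub0mx.
  rewrite [_ *m _](@thin_mx_eq _ _ _ _ 0) ?sub0mx //.
  by rewrite !dX snk // eqxx orbT.
rewrite (bigD1 U) //= [X in _ + X]big1 ?addr0.
  rewrite !(introT (has_dimP _ _)) ?mulr1 // => j; rewrite ?sub_of_dim //.
  by apply/eqP; rewrite -(eqn_add2r (\rank (U j))) quo_of_dim rU dX -dd'.
move=> V /andP[sV nVU]; rewrite -natrM mulnb; case: andP => // -[_ /has_dimP s].
case/eqP: nVU; apply/ffunP => j; rewrite ffunE -[LHS]is_subrep_genmx //.
apply: eq_genmx; have := s j; rewrite sub_of_dim /vertex_dim.
have [->|_] := eqVneq j i => rV.
  by apply/eqmxP; rewrite submx1 sub1mx -col_leq_rank rV mul1n dX leqnn.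
by rewrite raddf0; apply/eqmxP; rewrite sub0mx andbT submx0 -mxrank_eq0 rV.
Qed.

End Composition.

(** * Torsion pairs *)

Section Torsion.
Variables (F : finFieldType) (Q : quiver) (w : 'I_(qn Q) -> int).
Local Notation rep := (rep F Q).
Implicit Types (A B M N X Y Z : rep) (d e : 'I_(qn Q) -> nat).
Local Notation hall := (hall F Q).
Local Notation wt := (weight w).
Local Notation wtr U := (wt (fun i => \rank (U i))).

Definition tfree X :=
  [forall V : subfam X, is_subrep V ==> (wtr V <= 0)].

(** Strictly smaller weight on proper subrepresentations means positive weight on nonzero quotients,
    stated without forming quotients. *)
Definition tors X :=
  [forall V : subfam X, is_subrep V ==>
     [forall i, row_full (V i)] || (wtr V < wt (rdim X))].

Section Image.
Variables (X Y : rep) (j : mor Y X).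
Hypotheses (hj : ishom j) (fj : forall i, row_free (j i)).

Definition img_fam : subfam X := [ffun i => <<j i>>%MS].

Lemma img_fam_subrep : is_subrep img_fam.
Proof.
apply/andP; split; apply/forallP => a; rewrite !ffunE ?genmx_id //.
by rewrite genmxE (eqmxMr _ (genmxE _)) hj submxMl.
Qed.

Lemma img_fam_rank i : \rank (img_fam i) = rdim Y i.
Proof. by rewrite ffunE genmxE (eqP (fj i)). Qed.

Lemma img_fam_full i : row_full (img_fam i) = row_full (j i).
Proof. by rewrite ffunE /row_full genmxE. Qed.

End Image.

Lemma tfreeP X : reflect
  (forall Y (j : mor Y X), ishom j -> (forall i, row_free (j i)) -> wt (rdim Y) <= 0)
  (tfree X).
Proof.
apply: (iffP forallP) => [fX Y j hj fj | fX V].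
  have /implyP/(_ (img_fam_subrep hj)) := fX (img_fam j).
  by rewrite (eq_weight _ (img_fam_rank fj)).
apply/implyP=> /is_subrep_stable sV.
exact: (fX (sub_of V) _ (sinc_hom sV) (sinc_free _)).
Qed.

Lemma torsP X : reflect
  (forall Y (j : mor Y X), ishom j -> (forall i, row_free (j i)) ->
     (forall i, row_full (j i)) \/ wt (rdim Y) < wt (rdim X))
  (tors X).
Proof.
apply: (iffP forallP) => [tX Y j hj fj | tX V].
  have /implyP/(_ (img_fam_subrep hj)) := tX (img_fam j).
  rewrite (eq_weight _ (img_fam_rank fj)) => /orP[/forallP jf|]; last by right.
  by left=> i; rewrite -img_fam_full.
apply/implyP=> /is_subrep_stable sV; apply/orP.
have [Vf|] := tX (sub_of V) _ (sinc_hom sV) (sinc_free _); [left | by right].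
by apply/forallP => i; rewrite /row_full -(sinc_eq (fun i => V i) i); apply: Vf.
Qed.

Lemma tfree_iso X Y : iso X Y -> tfree X = tfree Y.
Proof.
suff imp A B : iso A B -> tfree A -> tfree B.
  by move=> XY; apply/idP/idP; apply: imp; rewrite // iso_sym.
move=> /isoP[f [g [hf hg fg gf]]] /tfreeP tA; apply/tfreeP => Z j hj fj.
apply: (tA Z (fun i => j i *m g i)); first exact: ishom_comp.
have gfree i : row_free (g i) by apply/row_freeP; exists (f i).
by move=> i; rewrite /row_free mxrankMfree //; apply: fj.
Qed.

Lemma tors_iso X Y : iso X Y -> tors X = tors Y.
Proof.
suff imp A B : iso A B -> tors A -> tors B.
  by move=> XY; apply/idP/idP; apply: imp; rewrite // iso_sym.
move=> AB /torsP tA; have /isoP[f [g [hf hg fg gf]]] := AB; apply/torsP => Z j hj fj.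
have gfree i : row_free (g i) by apply/row_freeP; exists (f i).
rewrite -(@eq_weight Q w (rdim A) (rdim B)); last by move=> i; exact: iso_dim.
have [||jg|] := tA Z (fun i => j i *m g i); [exact: ishom_comp| | |by right].
  by move=> i; rewrite /row_free mxrankMfree //; apply: fj.
left=> i; apply/eqP; rewrite -[RHS](iso_dim i AB) -[RHS](eqP (jg i)).
by rewrite mxrankMfree.
Qed.

Section Lattice.
Variables (X : rep) (U : subfam X).
Hypothesis sU : is_subrep U.
Let stU := is_subrep_stable sU.

(** Subrepresentations of the quotient correspond to those of [X] above [U], and weights are
    additive: the condition is that [U] has maximal weight among them. *)
Lemma tfree_quoP : tfree (quo_of U) <->
  forall V : forall i, 'M[F]_(rdim X i), stable V ->
    (forall i, (U i <= V i)%MS) -> wtr V <= wtr U.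
Proof.
pose q := qproj (fun i => U i); have hq : ishom q := qproj_hom stU.
have fq i : row_full (q i) := qbase_full _ i.
have kq i : (kermx (q i) :=: U i)%MS := qbase_ker (fun i => U i) i.
have rk (V : forall i, 'M[F]_(rdim X i)) i : (U i <= V i)%MS ->
    \rank (V i) = (\rank (U i) + \rank (V i *m q i))%N.
  move=> UV; rewrite -(mxrank_mul_ker (V i) (q i)) addnC; congr (_ + _)%N.
  by rewrite (cap_eqmx (eqmx_refl _) (kq i)) (capmx_idPr UV).
split=> [/tfreeP fU V sV UV | fU].
  rewrite (eq_weight _ (fun i => rk V i (UV i))) weightD gerDl.
  pose W i := V i *m q i.
  have sW : stable W.
    by move=> a; rewrite /W -mulmxA hq mulmxA submxMr.
  exact: (fU (srep W) _ (sinc_hom sW) (sinc_free W)).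
(* [V] is the preimage in [X] of the image of [j]. *)
apply/tfreeP => Y j hj fj; pose V i := kermx (q i *m cokermx (j i)).
have Vq i : (V i *m q i :=: j i)%MS.
  apply/eqmxP/andP; split; first by rewrite submxE -mulmxA mulmx_ker.
  rewrite -[j i]mulmx1 -(mulVpmx (fq i)) mulmxA submxMr //.
  by apply/sub_kermxP; rewrite mulmxA -(mulmxA (j i)) mulVpmx // mulmx1 mulmx_coker.
have UV i : (U i <= V i)%MS.
  by rewrite -kq; apply/sub_kermxP; rewrite mulmxA mulmx_ker mul0mx.
have sV : stable V.
  move=> a; apply/sub_kermxP; rewrite [LHS]mulmxA -(mulmxA (V _) _ (q _)) -hq.
  by apply/eqP; rewrite -submxE mulmxA (eqmxMr _ (Vq _)) hj submxMl.
have := fU V sV UV; rewrite (eq_weight _ (fun i => rk V i (UV i))) weightD gerDl.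
by rewrite (@eq_weight _ _ _ (rdim Y)) // => i; rewrite Vq (eqP (fj i)).
Qed.

Lemma tors_subP : tors (sub_of U) <->
  forall W : forall i, 'M[F]_(rdim X i), stable W ->
    (forall i, (W i <= U i)%MS) -> (forall i, (U i <= W i)%MS) \/ wtr W < wtr U.
Proof.
pose s := sinc (fun i => U i); have hs : ishom s := sinc_hom stU.
have fs i : row_free (s i) := sinc_free _ i.
have sE i : (s i :=: U i)%MS := sinc_eq (fun i => U i) i.
split=> [/torsP tU W sW WU | tU].
  have [j jE] : exists j : mor (srep W) (sub_of U),
      forall i, j i *m s i = sinc W i.
    exists (fun i => sinc W i *m pinvmx (s i)) => i.
    by rewrite mulmxKpV // sE sinc_eq.
  have hj : ishom j.
    move=> a; apply: (row_free_inj (fs (qtgt a))).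
    rewrite -[j _ *m _ *m _]mulmxA -[_ *m j _ *m _]mulmxA jE -hs mulmxA jE.
    exact: sinc_hom.
  have rj i : \rank (j i) = \rank (W i).
    by rewrite -(mxrankMfree _ (fs i)) jE sinc_eq.
  have [i||?] := tU (srep W) j hj; [by rewrite /row_free rj | | by right].
  move=> jf; left=> i; rewrite -(geq_leqif (mxrank_leqif_sup (WU i))).
  by rewrite -rj (eqP (jf i)).
apply/torsP => Y j hj fj; pose W i := <<j i *m s i>>%MS.
have rW i : \rank (W i) = rdim Y i by rewrite genmxE mxrankMfree // (eqP (fj i)).
have sW : stable W.
  move=> a; rewrite genmxE (eqmxMr _ (genmxE _)) -mulmxA hs mulmxA hj -mulmxA.
  by rewrite submxMl.
have WU i : (W i <= U i)%MS by rewrite genmxE -sE submxMl.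
have [UW|] := tU W sW WU; last by right; rewrite -(eq_weight _ rW).
left=> i; rewrite -col_leq_rank [X in (_ <= X)%N](eqP (fj i)) -rW.
exact: mxrankS (UW i).
Qed.

End Lattice.

Definition torsion_sub X (U : subfam X) :=
  [&& is_subrep U, tfree (quo_of U) & tors (sub_of U)].

Lemma weight_cap_sum X (U V : forall i, 'M[F]_(rdim X i)) :
  wt (fun i => \rank (U i + V i)%MS) + wt (fun i => \rank (U i :&: V i)%MS) =
  wtr U + wtr V.
Proof. by rewrite -!weightD; apply: eq_weight => i; exact: mxrank_sum_cap. Qed.

(** If [U] is not inside [V], then [U :&: V] weighs less than [U], while [U + V] weighs at most as
    much as [V]; this contradicts additivity of the weight on sum and intersection. *)
Lemma torsion_sub_le X (U V : subfam X) :
  torsion_sub U -> torsion_sub V -> forall i, (U i <= V i)%MS.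
Proof.
move=> /and3P[sU _ /(tors_subP sU) tU] /and3P[sV /(tfree_quoP sV) fV _].
have stU := is_subrep_stable sU; have stV := is_subrep_stable sV.
have sD : stable (fun i => U i + V i)%MS.
  by move=> a; rewrite addsmxMr addsmxS.
have sI : stable (fun i => U i :&: V i)%MS.
  move=> a; rewrite sub_capmx.
  rewrite (submx_trans (submxMr _ (capmxSl _ _)) (stU a)).
  by rewrite (submx_trans (submxMr _ (capmxSr _ _)) (stV a)).
have := fV _ sD (fun i => addsmxSr _ _).
have [UI _ i|lt le] := tU _ sI (fun i => capmxSl _ _).
  exact: submx_trans (UI i) (capmxSr _ _).
have := ltr_leD lt le; rewrite addrC.
by rewrite (weight_cap_sum (fun i => U i) (fun i => V i)) ltxx.
Qed.

Lemma torsion_sub_unique X (U V : subfam X) :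
  torsion_sub U -> torsion_sub V -> U = V.
Proof.
move=> tU tV; apply/ffunP => i; have [/and3P[sU _ _] /and3P[sV _ _]] := (tU, tV).
rewrite -[LHS]is_subrep_genmx // -[RHS]is_subrep_genmx //.
by apply/eq_genmx/eqmxP; rewrite !torsion_sub_le.
Qed.

(* Maximizing the weight and then minimizing the dimension; the factor
   exceeds every dimension, so a single integer encodes both. *)
Lemma torsion_sub_exists X : exists U : subfam X, torsion_sub U.
Proof.
pose D := (\sum_i rdim X i)%N.
pose dm (U : forall i, 'M[F]_(rdim X i)) := (\sum_i \rank (U i))%N.
pose score (U : forall i, 'M[F]_(rdim X i)) : int := wtr U * D.+1%:Z - (dm U)%:Z.
have s0 : is_subrep ([ffun i => 0] : subfam X).
  apply/andP; split; apply/forallP => a; rewrite !ffunE ?genmx0 //.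
  by rewrite mul0mx sub0mx.
have [U sU max] : exists2 U : subfam X, is_subrep U &
    forall V : subfam X, is_subrep V -> score (fun i => V i) <= score (fun i => U i).
  by case: (arg_maxP (fun U : subfam X => score (fun i => U i)) s0) => U; exists U.
have {}max (V : forall i, 'M[F]_(rdim X i)) : stable V -> score V <= score (fun i => U i).
  move=> sV; pose V' : subfam X := [ffun i => <<V i>>%MS].
  have sV' : is_subrep V'.
    apply/andP; split; apply/forallP => a; rewrite !ffunE ?genmx_id //.
    by rewrite genmxE (eqmxMr _ (genmxE _)); apply: sV.
  have rV i : \rank (V' i) = \rank (V i) by rewrite ffunE genmxE.
  have := max V' sV'; rewrite {1}/score (eq_weight _ rV) /dm.
  by rewrite (eq_bigr _ (fun i _ => rV i)).
have dmS (V W : forall i, 'M[F]_(rdim X i)) :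
    (forall i, (V i <= W i)%MS) -> (dm V <= dm W)%N.
  by move=> VW; apply: leq_sum => i _; apply: mxrankS.
have dmD V : (dm V <= D)%N by apply: leq_sum => i _; apply: rank_leq_row.
exists U; apply/and3P; split=> //.
  (* A gain of weight would raise the score by at least [D.+1], more than the added dimension can
     cost. *)
  apply/(tfree_quoP sU) => V sV UV.
  have := max V sV; rewrite /score; have := dmD V; have := dmS _ _ UV.
  move: (dm _) (dm V) (wtr V) (wtr U) => x y a b; nia.
apply/(tors_subP sU) => W sW WU.
have [UW|nUW] := classic (forall i, (U i <= W i)%MS); [by left | right].
(* Since the dimension drops, a weight no smaller than that of [U] would give [W] a higher score. *)
have : (dm W < dm (fun i => U i))%N.
  rewrite ltn_neqAle dmS // andbT; apply: contra_notN nUW => /eqP e i.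
  have := leqif_sum (fun i (_ : true) => mxrank_leqif_sup (WU i)).
  by move=> [_]; rewrite -/(dm W) e eqxx => /esym/forallP/(_ i).
have := max W sW; rewrite /score.
move: (dm _) (dm W) (wtr W) (wtr U) => x y a b; nia.
Qed.

End Torsion.

(** * Torsion classes in the composition algebra *)

Section TorsionClasses.
Variables (F : finFieldType) (Q : quiver) (w : 'I_(qn Q) -> int).
Local Notation rep := (rep F Q).
Implicit Types (A B M N X Y Z : rep) (d e : 'I_(qn Q) -> nat).
Local Notation hall := (hall F Q).
Local Notation comp := (@composition_alg F Q).

Definition ind_tfree d : hall := fun X => (has_dim d X && tfree w X)%:R.
Definition ind_tors d : hall := fun X => (has_dim d X && tors w X)%:R.

Lemma ind_tfree_inv d : iso_inv (ind_tfree d).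
Proof. by move=> X Y XY; rewrite /ind_tfree (has_dim_iso d XY) (tfree_iso w XY). Qed.

Lemma ind_tors_inv d : iso_inv (ind_tors d).
Proof. by move=> X Y XY; rewrite /ind_tors (has_dim_iso d XY) (tors_iso w XY). Qed.

(** After exchanging sums, a subrepresentation [U] meets only the index [e = dim U], and it counts
    exactly when it is the torsion subrepresentation, which exists and is unique. *)
Lemma sum_torsion_classes d X :
  \sum_(e : {ffun 'I_(qn Q) -> 'I_(\sum_i d i).+1} | [forall i, e i <= d i]%N)
    hmul (ind_tfree (fun i => d i - e i)%N) (ind_tors (fun i => e i : nat)) X =
  ind_dim d X.
Proof.
set D := (\sum_i d i)%N.
under eq_bigr => e _ do
  rewrite (hmulE _ (ind_tfree_inv _) (ind_tors_inv _)).
rewrite exchange_big /=.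
transitivity (\sum_(U : subfam X | is_subrep U)
                (has_dim d X && (tfree w (quo_of U) && tors w (sub_of U)))%:R : rat).
  apply: eq_bigr => U sU; have [dX | ndX] /= := boolP (has_dim d X); last first.
    apply: big1 => e /forallP le_ed; rewrite -natrM mulnb.
    case: andP => // -[/andP[/has_dimP q _] /andP[/has_dimP s _]].
    case/has_dimP: ndX => i; rewrite -(quo_of_dim U) q -sub_of_dim s.
    by rewrite subnK.
  have Xd := has_dimP _ _ dX.
  have rd i : (\rank (U i) <= d i)%N by rewrite -Xd rank_leq_row.
  (* The default of [inord] is never reached: each rank is at most [d i], hence at most [D]. *)
  pose e0 : {ffun 'I_(qn Q) -> 'I_D.+1} := [ffun i => inord (\rank (U i))].
  have e0E i : e0 i = \rank (U i) :> nat.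
    rewrite ffunE inordK // ltnS (leq_trans (rd i)) // /D (bigD1 i) //=.
    exact: leq_addr.
  rewrite (bigD1 e0) /=; last by apply/forallP => i; rewrite e0E.
  rewrite big1 ?addr0 => [|e /andP[le_ed /eqP ne]].
    rewrite -natrM mulnb /ind_tfree /ind_tors.
    rewrite (introT (has_dimP _ (quo_of U))) => [|i] /=; last by rewrite e0E -Xd.
    by rewrite (introT (has_dimP _ (sub_of U))) // => i; rewrite e0E.
  rewrite -natrM mulnb; case: andP => // -[_ /andP[/has_dimP s _]]; case: ne.
  by apply/ffunP => i; apply: val_inj; rewrite /= e0E -sub_of_dim s.
rewrite /ind_dim; have [dX | ndX] /= := boolP (has_dim d X); last by rewrite big1.
have [U tU] := torsion_sub_exists w X; have /and3P[sU fU rU] := tU.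
rewrite (bigD1 U) //= fU rU big1 ?addr0 // => V /andP[sV nVU].
case: (boolP (_ && _)) => // tV; case/eqP: nVU.
by apply: (torsion_sub_unique _ tU); rewrite /torsion_sub sV.
Qed.

Lemma ind_tfree0 d : (forall i, d i = 0%N) -> ind_tfree d =1 @hone F Q.
Proof.
move=> d0 X; rewrite -(ind_dim0 d0); congr (nat_of_bool _)%:R.
case: has_dimP => //= dX; apply/tfreeP => Y j hj fj.
rewrite /weight big1 // => i _; have : (rdim Y i <= 0)%N.
  by rewrite -(d0 i) -dX -[X in (X <= _)%N](eqP (fj i)) rank_leq_col.
by rewrite leqn0 => /eqP->; rewrite mulr0.
Qed.

Lemma ind_tors0 d : (forall i, d i = 0%N) -> ind_tors d =1 @hone F Q.
Proof.
move=> d0 X; rewrite -(ind_dim0 d0); congr (nat_of_bool _)%:R.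
case: has_dimP => //= dX; apply/torsP => Y j hj fj.
by left=> i; rewrite -col_leq_rank [X in (X <= _)%N]dX d0.
Qed.

(** The zero subrepresentation is proper and has weight 0, so a torsion representation would need
    positive weight. *)
Lemma ind_tors_eq0 d i : (0 < d i)%N -> weight w d <= 0 -> ind_tors d =1 fun=> 0.
Proof.
move=> di wd X; rewrite /ind_tors; case: has_dimP => //= dX.
case: torsP => // /(_ (zero_rep F Q) (fun=> 0)) [a|k|/(_ i)|].
- by rewrite mul0mx mulmx0.
- by rewrite -row_leq_rank.
- by rewrite -col_leq_rank mxrank0 leqNgt [X in (_ < X)%N]dX di.
rewrite (eq_weight _ dX) {1}/weight big1 => [|k _]; last by rewrite mulr0.
by rewrite ltNge wd.
Qed.

Lemma ind_tfree_eq0 d : 0 < weight w d -> ind_tfree d =1 fun=> 0.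
Proof.
move=> wd X; rewrite /ind_tfree; case: has_dimP => //= dX.
case: tfreeP => // /(_ X (fun=> 1%:M) (@ishom_id F Q X)).
rewrite (eq_weight _ dX) leNgt wd => tX; suff : false by [].
apply: tX => i.
by rewrite row_free_unit unitmx1.
Qed.

Hypothesis acQ : acyclic Q.

(** In the sum over [e], every term other than [e = 0] and [e = d] involves two strictly smaller
    dimension vectors and is covered by induction. *)
Lemma comp_torsion_classes d : comp (ind_tfree d) /\ comp (ind_tors d).
Proof.
have [n le_dn] := ubnP (\sum_i d i)%N; elim: n d le_dn => // n IH d le_dn.
have [/existsP [i0 di0] | /existsPn d0] := boolP [exists i, 0 < d i]%N; last first.
  have {}d0 i : d i = 0%N by apply/eqP; rewrite -leqn0 leqNgt.
  split; apply: (gen_ext (gen_one _)) => X.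
    by rewrite (ind_tfree0 d0).
  by rewrite (ind_tors0 d0).
pose D := (\sum_i d i)%N; pose T := {ffun 'I_(qn Q) -> 'I_D.+1}.
have dD i : (d i < D.+1)%N by rewrite ltnS /D (bigD1 i) //= leq_addr.
(* These two indices contribute [ind_tfree d] and [ind_tors d], each multiplied by the unit. *)
pose e0 : T := [ffun i => ord0]; pose e1 : T := [ffun i => Ordinal (dD i)].
have ne : e1 != e0.
  apply/eqP => /ffunP/(_ i0)/(congr1 val); rewrite !ffunE /= => e.
  by rewrite e in di0.
pose rest : hall := fun X => \sum_(e : T | [forall i, e i <= d i]%N && (e != e0) && (e != e1))
  hmul (ind_tfree (fun i => d i - e i)%N) (ind_tors (fun i => e i : nat)) X.
have crest : comp rest.
  apply: comp_sum => e /andP[/andP[/forallP le_ed ne0] ne1].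
  have e_sum : (\sum_i d i = \sum_i (d i - e i)%N + \sum_i e i)%N.
    by rewrite -big_split; apply: eq_bigr => i _ /=; rewrite subnK.
  have e_gt0 : (0 < \sum_i e i)%N.
    rewrite lt0n sum_nat_eq0; apply: contraNN ne0 => /forallP e_0.
    by apply/eqP/ffunP => i; apply/val_inj; rewrite ffunE /=; apply/eqP/e_0.
  have de_gt0 : (0 < \sum_i (d i - e i)%N)%N.
    rewrite lt0n sum_nat_eq0; apply: contraNN ne1 => /forallP e_0.
    apply/eqP/ffunP => i; apply/val_inj; rewrite ffunE /=; apply/eqP.
    by rewrite eqn_leq le_ed -subn_eq0; exact: e_0.
  apply: gen_mul.
    apply: (IH _ _).1; rewrite -ltnS (leq_trans _ le_dn) // ltnS e_sum.
    by rewrite -[X in (X < _)%N]addn0 ltn_add2l.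
  apply: (IH _ _).2; rewrite -ltnS (leq_trans _ le_dn) // ltnS e_sum.
  by rewrite -[X in (X < _)%N]add0n ltn_add2r.
have sumE X : ind_dim d X = ind_tfree d X + ind_tors d X + rest X.
  rewrite -sum_torsion_classes (bigD1 e0) /=; last by apply/forallP => i; rewrite ffunE.
  rewrite (bigD1 e1) /=; last by rewrite ne andbT; apply/forallP => i; rewrite ffunE.
  rewrite addrA; congr (_ + _ + _).
    rewrite -[RHS]hmul1; last exact: ind_tfree_inv.
    apply: eq_hmul => Y; last by apply: ind_tors0 => i; rewrite ffunE.
    congr (nat_of_bool (_ && _))%:R; apply: eq_forallb => i.
    by rewrite ffunE /= subn0.
  rewrite -[RHS]mul1h; last exact: ind_tors_inv.
  apply: eq_hmul => Y; first by apply: ind_tfree0 => i; rewrite ffunE /= subnn.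
  by congr (nat_of_bool (_ && _))%:R; apply: eq_forallb => i; rewrite ffunE.
have crem := comp_sub (comp_ind_dim F acQ d) crest.
(* The sign of the weight makes one of the two remaining terms vanish, and the other is what is left
   of [ind_dim d]. *)
have [wd | wd] := leP (weight w d) 0.
  have t0 := ind_tors_eq0 di0 wd; split.
    by apply: (gen_ext crem) => X; rewrite sumE t0 addr0 addrK.
  by apply: (gen_ext (gen_scale 0 (gen_one _))) => X; rewrite t0 mul0r.
have f0 := ind_tfree_eq0 wd; split; last first.
  by apply: (gen_ext crem) => X; rewrite sumE f0 add0r addrK.
by apply: (gen_ext (gen_scale 0 (gen_one _))) => X; rewrite f0 mul0r.
Qed.

End TorsionClasses.

(** * Exceptional, preprojective and preinjective classes *)

Section Exceptional.
Variables (F : finFieldType) (Q : quiver).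
Hypothesis acQ : acyclic Q.
Local Notation rep := (rep F Q).
Implicit Types (A B M N X Y Z : rep).
Local Notation comp := (@composition_alg F Q).

(** For the Euler weight of [M], the torsion-free representations of dimension [dim M] are exactly
    those isomorphic to [M]. *)
Lemma comp_exceptional M : indecomposable M -> ext0 M M -> comp (cls M).
Proof.
move=> indM eMM; pose w := euler_weight (rdim M).
have cw := comp_torsion_classes F w acQ (rdim M).
apply: (gen_ext cw.1) => X.
congr (nat_of_bool _)%:R; apply/andP/idP => [[/has_dimP dX /tfreeP fX] | XM].
  exact: semistable_exceptional.
split; first by apply/has_dimP => i; exact: iso_dim.
rewrite (tfree_iso _ XM); apply/tfreeP => Y j hj fj.
have [/existsP[i Yi] | /existsPn Y0] := boolP [exists i, 0 < rdim Y i]%N; last first.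
  rewrite /weight big1 // => i _.
  by have := Y0 i; rewrite -leqNgt leqn0 => /eqP->; rewrite mulr0.
have [/forallP jf | /forallPn[k jk]] := boolP [forall k, row_full (j k)].
  rewrite (@eq_weight _ _ _ (rdim M)) ?weight_euler ?subrr // => k.
  by rewrite -[LHS](eqP (fj k)) -[RHS](eqP (jf k)).
exact/ltW/(exceptional_stable indM eMM hj fj Yi jk).
Qed.

Lemma biprod_ext0r N X A B : biprod X A B -> ext0 N A -> ext0 N B -> ext0 N X.
Proof.
move=> [sA [rA [sB [rB [[hsA hrA hsB hrB] k]]]]] eA eB c.
have [f fE] := eA (fun a => c a *m rA (qtgt a)).
have [g gE] := eB (fun a => c a *m rB (qtgt a)).
exists (fun i => f i *m sA i + g i *m sB i) => a.
have [_ _ _ _ e] := k (qtgt a).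
rewrite -[LHS]mulmx1 -e mulmxDr !mulmxA fE gE !mulmxBl mulmxDl mulmxDr.
by rewrite -[f _ *m rmap A _ *m _]mulmxA -[g _ *m rmap B _ *m _]mulmxA -hsA -hsB !mulmxA opprD addrACA.
Qed.

Lemma biprod_ext0l N X A B : biprod X A B -> ext0 A N -> ext0 B N -> ext0 X N.
Proof.
move=> [sA [rA [sB [rB [[hsA hrA hsB hrB] k]]]]] eA eB c.
have [f fE] := eA (fun a => sA (qsrc a) *m c a).
have [g gE] := eB (fun a => sB (qsrc a) *m c a).
exists (fun i => rA i *m f i + rB i *m g i) => a.
have [_ _ _ _ e] := k (qsrc a).
rewrite -[LHS]mul1mx -e mulmxDl -!mulmxA fE gE !mulmxBr mulmxDl mulmxDr.
by rewrite !mulmxA hrA hrB opprD addrACA.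
Qed.

(** Induction along a decomposition into indecomposables; only its existence enters. *)
Lemma summand_ind (P : rep -> Prop) X :
  (forall Y, (forall i, rdim Y i = 0%N) -> P Y) ->
  (forall Y A B, biprod Y A B -> P A -> P B -> P Y) ->
  (forall Y, indecomposable Y -> is_summand Y X -> P Y) -> P X.
Proof.
move=> P0 PD PX.
have [n le_n] := ubnP (\sum_i rdim X i)%N; elim: n X le_n PX => // n IH X le_n PX.
have [/existsP X0 | /existsPn X0] := boolP [exists i, 0 < rdim X i]%N; last first.
  by apply: P0 => i; apply/eqP; rewrite -leqn0 leqNgt.
have [indX | nindX] := classic (indecomposable X).
  apply: PX => //; exists (ffhom (fun=> 1%:M)), (ffhom (fun=> 1%:M)); split.
  - exact/is_hom_ff/ishom_id.
  - exact/is_hom_ff/ishom_id.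
  - by move=> i; rewrite !ffhomE mulmx1.
have [A [B [XAB [i Ai] [j Bj]]]] := not_indecomposable_biprod X0 nindX.
have dX : (\sum_i rdim X i = \sum_i rdim A i + \sum_i rdim B i)%N.
  by rewrite -big_split; apply: eq_bigr => k _; exact: biprod_dim XAB.
have sA : (0 < \sum_i rdim A i)%N by rewrite (bigD1 i) //= ltn_addr.
have sB : (0 < \sum_i rdim B i)%N by rewrite (bigD1 j) //= ltn_addr.
rewrite dX in le_n; apply: (PD _ _ _ XAB).
  apply: IH => [|Y indY YA]; first by lia.
  exact/(PX _ indY)/(summand_trans YA)/(biprod_summandl XAB).
apply: IH => [|Y indY YB]; first by lia.
exact/(PX _ indY)/(summand_trans YB)/(biprod_summandl (biprod_sym XAB)).
Qed.

(** Without such a summand, [summand_ind] would show every dimension of [X] to be zero. *)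
Lemma exists_indecomposable_summand X : (exists i, 0 < rdim X i)%N ->
  exists2 N, indecomposable N & is_summand N X.
Proof.
move=> [i Xi]; apply: NNPP => nN.
suff X0 k : rdim X k = 0%N by rewrite X0 in Xi.
apply: (@summand_ind (fun Y => rdim Y k = 0%N)) => // [Y A B YAB A0 B0 | Y indY YX].
  by rewrite (biprod_dim k YAB) A0 B0.
by case: nN; exists Y.
Qed.

(* [R] is [Ext^1 = 0] in either order of the arguments. *)
Lemma comp_of_levels (lvl : nat -> rep -> Prop) (R : rep -> rep -> Prop) :
  (forall N X, (forall i, rdim X i = 0%N) -> R N X) ->
  (forall N X A B, biprod X A B -> R N A -> R N B -> R N X) ->
  (forall X A B, biprod X A B -> R A B -> comp (cls A) -> comp (cls B) -> comp (cls X)) ->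
  (forall N, R N N -> ext0 N N) ->
  (forall r s M N, lvl r M -> lvl s N -> (r <= s)%N -> R M N) ->
  forall M, (forall N, indecomposable N -> is_summand N M -> exists r, lvl r N) ->
  comp (cls M).
Proof.
move=> R0 RD Rcomp Rext Rlvl M.
have [n le_n] := ubnP (\sum_i rdim M i)%N; elim: n M le_n => // n IH M le_n lM.
have [/existsP M0 | /existsPn M0] := boolP [exists i, 0 < rdim M i]%N; last first.
  apply: comp_iso (gen_one _); rewrite iso_sym iso_zero; apply/has_dimP => i.
  by apply/eqP; rewrite -leqn0 leqNgt.
pose S r := exists N, [/\ indecomposable N, is_summand N M & lvl r N].
(* [N] is a summand of least level, so that [R N] holds for every indecomposable summand of its
   complement. *)
have [r [N [indN NM rN]] rmin] : exists2 r, S r & forall s, S s -> (r <= s)%N.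
  have [N indN NM] := exists_indecomposable_summand M0; have [r rN] := lM N indN NM.
  have {N indN NM rN} : S r by exists N.
  elim/ltn_ind: r => r IHr Sr.
  have [[s lt_sr Ss] | nS] := classic (exists2 s, (s < r)%N & S s); first exact: IHr Ss.
  by exists r => // s Ss; rewrite leqNgt; apply/negP => lt_sr; apply: nS; exists s.
have [M' MNM'] := summand_biprod NM.
have M'M : is_summand M' M := biprod_summandl (biprod_sym MNM').
apply: (Rcomp _ _ _ MNM').
- apply: summand_ind => [Y Y0 | Y A B | Y indY YM']; [exact: R0 | exact: RD |].
  have YM := summand_trans YM' M'M; have [s sY] := lM Y indY YM.
  by apply: (Rlvl _ _ _ _ rN sY); apply: rmin; exists Y; split.
- by apply: comp_exceptional => //; apply: Rext; apply: (Rlvl _ _ _ _ rN rN).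
apply: IH => [|Y indY YM']; last exact/(lM _ indY)/(summand_trans YM').
have [[i Ni] _] := indN; have sN : (0 < \sum_i rdim N i)%N by rewrite (bigD1 i) //= ltn_addr.
have dM : (\sum_i rdim M i = \sum_i rdim N i + \sum_i rdim M' i)%N.
  by rewrite -big_split; apply: eq_bigr => k _; exact: biprod_dim MNM'.
by rewrite dM in le_n; lia.
Qed.

Lemma ext0_zero_r N X : (forall i, rdim X i = 0%N) -> ext0 N X.
Proof. by move=> X0 c; exists (fun=> 0) => a; apply: thin_mx_eq; rewrite X0 orbT. Qed.

Lemma ext0_zero_l N X : (forall i, rdim X i = 0%N) -> ext0 X N.
Proof. by move=> X0 c; exists (fun=> 0) => a; apply: thin_mx_eq; rewrite X0. Qed.

Lemma comp_preprojective M : preprojective M -> comp (cls M).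
Proof.
move=> ppM; apply: (@comp_of_levels (@preproj_level F Q) (@ext0 F Q)) => //.
- exact: ext0_zero_r.
- exact: biprod_ext0r.
- exact: comp_biprod.
- exact: preproj_level_ext0.
by move=> N indN NM; apply: preproj_ind_level; apply: ppM.
Qed.

Lemma comp_preinjective M : preinjective M -> comp (cls M).
Proof.
move=> piM; apply: (@comp_of_levels (@preinj_level F Q) (fun N X => ext0 X N)) => //.
- exact: ext0_zero_l.
- exact: biprod_ext0l.
(* Here [R A B] is [Ext^1(B, A) = 0], so the product is taken in the opposite order. *)
- by move=> X A B /biprod_sym XBA eBA cA cB; apply: comp_biprod XBA eBA cB cA.
- by move=> r s N M' rN sM' le_rs; apply: preinj_level_ext0 rN sM' le_rs.
by move=> N indN NM; apply: preinj_ind_level; apply: piM.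
Qed.

End Exceptional.

Lemma gen_sub_mono (F : finFieldType) (Q : quiver) (S S' : hall F Q -> Prop) h :
  (forall f, S f -> gen_sub S' f) -> gen_sub S h -> gen_sub S' h.
Proof.
move=> SS'; elim=> {h}.
- exact: SS'.
- exact: gen_one.
- by move=> f g _ cf _ cg; apply: gen_add.
- by move=> c f _ cf; apply: gen_scale.
- by move=> f g _ cf _ cg; apply: gen_mul.
- by move=> f g _ cf fg; apply: gen_ext cf fg.
Qed.

Theorem theorem2p3 (F : finFieldType) (Q : quiver) :
  acyclic Q ->
  (forall h : hall F Q, preproj_alg h -> composition_alg h) /\
  (forall h : hall F Q, preinj_alg h -> composition_alg h).
Proof.
move=> acQ; split=> h; apply: gen_sub_mono => f [M [ppM ->]].
  exact: comp_preprojective.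
exact: comp_preinjective.
Qed.
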